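(* Let $H=\{H_\alpha\}_{\alpha\in\pi}$ be a finite dimensional Hopf $\pi$-coalgebra with antipode $S=\{S_\alpha\}_{\alpha\in\pi}$. Then: (a) if $\alpha\in\pi$ has finite order $d$, then $(S_{\alpha^{-1}}S_\alpha)^{2d\dim H_1}=\mathrm{id}_{H_\alpha}$; (b) if $\alpha\in\pi$ has order $2$, then $S_\alpha^{8\dim H_1}=\mathrm{id}_{H_\alpha}$.
   Context: Throughout, $\pi$ is a discrete group with neutral element $1$, $\Bbbk$ is a field, $\otimes=\otimes_\Bbbk$, and algebras are associative and unital over $\Bbbk$ (the zero algebra is allowed). A $\pi$-coalgebra is a family $C=\{C_\alpha\}_{\alpha\in\pi}$ of $\Bbbk$-spaces with $\Bbbk$-linear maps $\Delta_{\alpha,\beta}:C_{\alpha\beta}\to C_\alpha\otimes C_\beta$ and $\epsilon:C_1\to\Bbbk$ such that $(\Delta_{\alpha,\beta}\otimes\mathrm{id}_{C_\gamma})\Delta_{\alpha\beta,\gamma}=(\mathrm{id}_{C_\alpha}\otimes\Delta_{\beta,\gamma})\Delta_{\alpha,\beta\gamma}$ and $(\mathrm{id}_{C_\alpha}\otimes\epsilon)\Delta_{\alpha,1}=\mathrm{id}_{C_\alpha}=(\epsilon\otimes\mathrm{id}_{C_\alpha})\Delta_{1,\alpha}$ for all $\alpha,\beta,\gamma\in\pi$. A Hopf $\pi$-coalgebra is a $\pi$-coalgebra $H=(\{H_\alpha\},\Delta,\epsilon)$ with $\Bbbk$-linear maps $S_\alpha:H_\alpha\to H_{\alpha^{-1}}$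 (the antipode) such that each $H_\alpha$ is an algebra with multiplication $m_\alpha$ and unit $1_\alpha$, the maps $\epsilon$ and all $\Delta_{\alpha,\beta}$ are algebra homomorphisms, and $m_\alpha(S_{\alpha^{-1}}\otimes\mathrm{id}_{H_\alpha})\Delta_{\alpha^{-1},\alpha}=\epsilon 1_\alpha=m_\alpha(\mathrm{id}_{H_\alpha}\otimes S_{\alpha^{-1}})\Delta_{\alpha,\alpha^{-1}}$ for all $\alpha$. $H$ is finite dimensional if every $H_\alpha$ is finite dimensional over $\Bbbk$. *)

(* Defs.v *)
From HB Require Import structures.
From mathcomp Require Import all_boot all_algebra.

Set Implicit Arguments.
Unset Strict Implicit.
Unset Printing Implicit Defensive.

Import GRing.Theory.
Local Open Scope ring_scope.

(** An element of V (x) W is the matrix of its coordinates on the products of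
    the elements of the bases [vbasis {:V}] and [vbasis {:W}].  The lemmas
    [tpure_bilinear], [tlift_pure] and [tensor_hom_ext] below state the
    universal property: [tensor V W] is the tensor product of V and W. *)

Section Tensor.

Variable k : fieldType.
Implicit Types U V W : vectType k.

Definition tensor V W : Type := 'M[k]_(\dim {:V}, \dim {:W}).

HB.instance Definition _ V W := Vector.on (tensor V W).

Definition tpure V W (v : V) (w : W) : tensor V W :=
  \matrix_(i, j) (coord (vbasis {:V}) i v * coord (vbasis {:W}) j w).

(* For b bilinear, the linear map V (x) W -> U with v (x) w |-> b v w. *)
Definition tlift V W (U : lmodType k) (b : V -> W -> U) (t : tensor V W) : U :=
  \sum_i \sum_j t i j *: b (vbasis {:V})`_i (vbasis {:W})`_j.

Definition bilinear_map V W (U : lmodType k) (b : V -> W -> U) : Prop :=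
  (forall w, linear (b^~ w)) /\ (forall v, linear (b v)).

Lemma tpure_bilinear V W : bilinear_map (@tpure V W).
Proof.
split=> [w c v v' | v c w w']; apply/matrixP=> i j; rewrite !mxE linearP /=.
  by rewrite mulrDl mulrA.
by rewrite mulrDr mulrCA.
Qed.

Lemma tlift_linear V W (U : lmodType k) (b : V -> W -> U) : linear (tlift b).
Proof.
move=> c x y; rewrite /tlift scaler_sumr -big_split; apply: eq_bigr => i _ /=.
rewrite scaler_sumr -big_split; apply: eq_bigr => j _ /=.
by rewrite !mxE scalerDl scalerA.
Qed.

HB.instance Definition _ V W (U : lmodType k) (b : V -> W -> U) :=
  GRing.isLinear.Build k (tensor V W) U _ (tlift b) (tlift_linear b).

Lemma linear_sumE V (U : lmodType k) (f : V -> U) (fl : linear f)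
    n (c : 'I_n -> k) (e : 'I_n -> V) :
  f (\sum_i c i *: e i) = \sum_i c i *: f (e i).
Proof.
have f0 : f 0 = 0 by have := fl (-1) 0 0; rewrite scaler0 addr0 scaleN1r addNr.
elim: n c e => [|n IHn] c e; first by rewrite !big_ord0.
by rewrite !big_ord_recl fl IHn.
Qed.

Lemma tlift_pure V W (U : lmodType k) (b : V -> W -> U) v w :
  bilinear_map b -> tlift b (tpure v w) = b v w.
Proof.
case=> bl br.
rewrite [in RHS](coord_vbasis (memvf v)) [in RHS](coord_vbasis (memvf w)).
rewrite (linear_sumE (bl _)); apply: eq_bigr => i _ /=.
rewrite (linear_sumE (br _)) scaler_sumr; apply: eq_bigr => j _.
by rewrite scalerA mxE.
Qed.

Lemma tensor_decomp V W (t : tensor V W) :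
  t = \sum_i \sum_j t i j *: tpure (vbasis {:V})`_i (vbasis {:W})`_j.
Proof.
have cE (X : vectType k) (i j : 'I_(\dim {:X})) :
    coord (vbasis {:X}) i (vbasis {:X})`_j = (i == j)%:R.
  by rewrite coord_free // ?(basis_free (vbasisP _)) // eq_sym.
apply/matrixP=> i j; rewrite summxE (bigD1 i) //= [X in _ + X]big1 ?addr0.
  rewrite summxE (bigD1 j) //= [X in _ + X]big1 ?addr0.
    by rewrite !mxE !cE !eqxx !mulr1.
  by move=> j' /negPf nj; rewrite !mxE !cE (eq_sym j) nj !mulr0.
move=> i' /negPf ni; rewrite summxE big1 // => j' _.
by rewrite !mxE !cE (eq_sym i) ni mul0r mulr0.
Qed.

Lemma tensor_hom_ext V W (U : lmodType k) (f g : {linear tensor V W -> U}) :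
  (forall v w, f (tpure v w) = g (tpure v w)) -> f =1 g.
Proof.
move=> fg t; rewrite (tensor_decomp t) !linear_sum; apply: eq_bigr => i _ /=.
by rewrite !linear_sum; apply: eq_bigr => j _ /=; rewrite !linearZ /= fg.
Qed.

Lemma tensor_ind V W (P : tensor V W -> Prop) :
    (forall v w, P (tpure v w)) ->
    (forall c x y, P x -> P y -> P (c *: x + y)) ->
  forall t, P t.
Proof.
move=> Pp Pl t.
have P0 : P 0 by have := Pl (-1) _ _ (Pp 0 0) (Pp 0 0); rewrite scaleN1r addNr.
have PZ c x : P x -> P (c *: x) by move/(Pl c x 0)/(_ P0); rewrite addr0.
have PD x y : P x -> P y -> P (x + y).
  by move=> Px Py; have := Pl 1 x y Px Py; rewrite scale1r.
rewrite (tensor_decomp t); apply: big_ind => // i _.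
by apply: big_ind => // j _; apply/PZ/Pp.
Qed.

Definition tmap V W V' W' (f : V -> V') (g : W -> W') :
    tensor V W -> tensor V' W' :=
  tlift (fun v w => tpure (f v) (g w)).

Definition tassoc U V W : tensor (tensor U V) W -> tensor U (tensor V W) :=
  tlift (fun x w => tlift (fun u v => tpure u (tpure v w)) x).

Definition tunitr V : tensor V k^o -> V := tlift (fun v (c : k^o) => c *: v).

Definition tunitl V : tensor k^o V -> V := tlift (fun (c : k^o) v => c *: v).

End Tensor.

(* The library's algType and falgType exclude the zero algebra, which is
   allowed here: nothing prevents [alg_one = 0]. *)
Record algebra_on (k : fieldType) (V : vectType k) := AlgebraOn {
  alg_mul : V -> V -> V;
  alg_one : V;
  alg_mul_bilinear : bilinear_map alg_mul;
  alg_mulA : associative alg_mul;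
  alg_mul1l : left_id alg_one alg_mul;
  alg_mul1r : right_id alg_one alg_mul
}.

(* Linearity of f is carried by its type. *)
Definition alg_morphism (k : fieldType) (V W : vectType k)
    (A : algebra_on V) (B : algebra_on W) (f : {linear V -> W}) : Prop :=
  f (alg_one A) = alg_one B /\
  forall x y, f (alg_mul A x y) = alg_mul B (f x) (f y).

Section BaseAlgebra.

Variable k : fieldType.

Lemma base_mul_bilinear :
  @bilinear_map k k^o k^o k^o (fun x y => (x : k) * (y : k)).
Proof.
split=> [y c u v | x c u v]; first by rewrite mulrDl -[c *: u]/(c * u) -mulrA.
by rewrite mulrDr -[c *: u]/(c * u) mulrCA.
Qed.

Definition base_alg : algebra_on k^o :=
  @AlgebraOn k k^o (fun x y => (x : k) * (y : k)) (1 : k)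
    base_mul_bilinear (@mulrA k) (@mul1r k) (@mulr1 k).

End BaseAlgebra.

Section TensorAlgebra.

Variables (k : fieldType) (V W : vectType k).
Variables (A : algebra_on V) (B : algebra_on W).
Implicit Types x y z : tensor V W.

Definition tmul x y : tensor V W :=
  tlift (fun a b => tlift (fun c d => tpure (alg_mul A a c) (alg_mul B b d)) y) x.

Definition tone : tensor V W := tpure (alg_one A) (alg_one B).

Let inner_bilin (a : V) (b : W) :
  bilinear_map (fun c d => tpure (alg_mul A a c) (alg_mul B b d)).
Proof.
have [pl pr] := tpure_bilinear V W.
have [_ mA] := alg_mul_bilinear A; have [_ mB] := alg_mul_bilinear B.
by split=> [d c u v | c e u v]; rewrite (mA, mB) (pl, pr).
Qed.

Let outer_bilin y : bilinear_map (fun a b =>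
  tlift (fun c d => tpure (alg_mul A a c) (alg_mul B b d)) y).
Proof.
have [pl pr] := tpure_bilinear V W.
have [mA _] := alg_mul_bilinear A; have [mB _] := alg_mul_bilinear B.
split=> [b c u v | a c u v]; rewrite /tlift scaler_sumr -big_split /=;
  apply: eq_bigr => i _; rewrite scaler_sumr -big_split /=;
  apply: eq_bigr => j _; rewrite (mA, mB) (pl, pr);
  by rewrite scalerDr !scalerA mulrC.
Qed.

Lemma tmul_pure (a c : V) (b d : W) :
  tmul (tpure a b) (tpure c d) = tpure (alg_mul A a c) (alg_mul B b d).
Proof. by rewrite /tmul tlift_pure // tlift_pure. Qed.

Lemma tmulPl c x y z : tmul (c *: x + y) z = c *: tmul x z + tmul y z.
Proof. exact: linearP. Qed.

Lemma tmulPr c x y z : tmul z (c *: x + y) = c *: tmul z x + tmul z y.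
Proof.
elim/tensor_ind: z => [a b | e u v Hu Hv].
  by rewrite /tmul !(tlift_pure _ _ (outer_bilin _)) linearP.
rewrite !tmulPl Hu Hv !scalerDr !scalerA (mulrC e).
by rewrite -!addrA; congr (_ + _); rewrite addrCA.
Qed.

Lemma tmul_bilinear : bilinear_map tmul.
Proof. by split=> [z c x y | z c x y]; rewrite (tmulPl, tmulPr). Qed.

Lemma tmulA : associative tmul.
Proof.
move=> x y z; elim/tensor_ind: x => [a b | e u v Hu Hv]; last first.
  by rewrite !tmulPl Hu Hv.
elim/tensor_ind: y => [c d | e u v Hu Hv]; last first.
  by rewrite tmulPl !tmulPr tmulPl Hu Hv.
elim/tensor_ind: z => [f g | e u v Hu Hv]; last first.
  by rewrite !tmulPr Hu Hv.
by rewrite !tmul_pure !alg_mulA.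
Qed.

Lemma tmul1l : left_id tone tmul.
Proof.
move=> x; elim/tensor_ind: x => [a b | e u v Hu Hv].
  by rewrite tmul_pure !alg_mul1l.
by rewrite tmulPr Hu Hv.
Qed.

Lemma tmul1r : right_id tone tmul.
Proof.
move=> x; elim/tensor_ind: x => [a b | e u v Hu Hv].
  by rewrite tmul_pure !alg_mul1r.
by rewrite tmulPl Hu Hv.
Qed.

(* The product is given by (a (x) b)(c (x) d) = ac (x) bd, see [tmul_pure]. *)
Definition tensor_alg : algebra_on (tensor V W) :=
  AlgebraOn tmul_bilinear tmulA tmul1l tmul1r.

End TensorAlgebra.

Definition alg_mul_tensor (k : fieldType) (V : vectType k) (A : algebra_on V) :
  tensor V V -> V := tlift (alg_mul A).

(* Finite dimensionality is part of [vectType].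
   [ecast g (C g) e x] transports x along the equality e between indices. *)
Record piCoalgebra (k : fieldType) (pi : groupType) := PiCoalgebra {
  pi_space :> pi -> vectType k;
  pi_comul : forall a b : pi,
    {linear pi_space (a * b)%g -> tensor (pi_space a) (pi_space b)};
  pi_counit : {linear pi_space 1%g -> k^o};
  pi_coassoc : forall (a b c : pi) (x : pi_space ((a * b) * c)%g),
    tassoc (tmap (pi_comul a b) id (pi_comul (a * b)%g c x)) =
    tmap id (pi_comul b c)
      (pi_comul a (b * c)%g (ecast g (pi_space g) (esym (mulgA a b c)) x));
  pi_counitr : forall (a : pi) (x : pi_space a),
    tunitr (tmap id pi_counit
      (pi_comul a 1%g (ecast g (pi_space g) (esym (mulg1 a)) x))) = x;
  pi_counitl : forall (a : pi) (x : pi_space a),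
    tunitl (tmap pi_counit id
      (pi_comul 1%g a (ecast g (pi_space g) (esym (mul1g a)) x))) = x
}.

Record hopfPiCoalgebra (k : fieldType) (pi : groupType) := HopfPiCoalgebra {
  hopf_coalg :> piCoalgebra k pi;
  hopf_alg : forall a : pi, algebra_on (hopf_coalg a);
  hopf_comul_morphism : forall a b : pi,
    alg_morphism (hopf_alg (a * b)%g) (tensor_alg (hopf_alg a) (hopf_alg b))
      (pi_comul hopf_coalg a b);
  hopf_counit_morphism :
    alg_morphism (hopf_alg 1%g) (base_alg k) (pi_counit hopf_coalg);
  hopf_antipode : forall a : pi, {linear hopf_coalg a -> hopf_coalg (a^-1)%g};
  hopf_antipodel : forall (a : pi) (x : hopf_coalg 1%g),
    alg_mul_tensor (hopf_alg a)
      (tmap (fun y => ecast g (hopf_coalg g) (invgK a)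
                        (hopf_antipode (a^-1)%g y)) id
        (pi_comul hopf_coalg (a^-1)%g a
          (ecast g (hopf_coalg g) (esym (mulVg a)) x)))
    = pi_counit hopf_coalg x *: alg_one (hopf_alg a);
  hopf_antipoder : forall (a : pi) (x : hopf_coalg 1%g),
    alg_mul_tensor (hopf_alg a)
      (tmap id (fun y => ecast g (hopf_coalg g) (invgK a)
                           (hopf_antipode (a^-1)%g y))
        (pi_comul hopf_coalg a (a^-1)%g
          (ecast g (hopf_coalg g) (esym (mulgV a)) x)))
    = pi_counit hopf_coalg x *: alg_one (hopf_alg a)
}.

(* The library's [order] is restricted to finite groups. *)
Definition has_order (pi : groupType) (a : pi) (d : nat) : Prop :=
  [/\ (0 < d)%N, (a ^+ d)%g = 1%g
    & forall m, (0 < m)%N -> (a ^+ m)%g = 1%g -> (d <= m)%N].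

Lemma has_order2_inv (pi : groupType) (a : pi) :
  has_order a 2 -> (a^-1)%g = a.
Proof. by case=> _ a2 _; apply: (mulgI a); rewrite mulgV -expg2 a2. Qed.

Section AntipodePowers.

Variables (k : fieldType) (pi : groupType) (H : hopfPiCoalgebra k pi) (a : pi).

(* S_(a^-1) S_a, whose codomain H_((a^-1)^-1) is identified with H_a *)
Definition antipode2 (x : H a) : H a :=
  ecast g (H g) (invgK a) (hopf_antipode H (a^-1)%g (hopf_antipode H a x)).

(* S_a as an endomorphism of H_a when a^-1 = a *)
Definition antipode_endo (e : (a^-1)%g = a) (x : H a) : H a :=
  ecast g (H g) e (hopf_antipode H a x).

End AntipodePowers.

(* Main.v *)
(** Summing H over the powers of alpha gives an ordinary Hopf algebra A, of
    dimension d dim H_1 unless H_alpha = 0, since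
    x (x) y |-> x y_1 (x) y_2 identifies H_b (x) H_b with H_b (x) H_1.  Radford's
    formula writes S^4 on A as a composite of commuting maps: conjugation by a
    grouplike element g and translations by a character nu.  As in the theorem of
    Nichols and Zoeller, the orders of g and nu divide dim A: if R is
    multiplication by g, resp. translation by nu, then R (x) R is conjugate to
    R (x) id, which forces A to be free over the group algebra of each primary
    part of <R>, the powers of R being linearly independent.  Hence
    S^(4 dim A) = id. *)

Require Import Defs.
From HB Require Import structures.
From mathcomp Require Import all_boot all_algebra all_field.

Set Implicit Arguments.
Unset Strict Implicit.
Unset Printing Implicit Defensive.

Import GRing.Theory.
Local Open Scope ring_scope.

(** * Linear maps out of tensor products *)

(** Why similarity of R (x) R with R (x) id is so rigid: let f(c) be the multiplicity of the
    eigenvalue c of R on a space of dimension n. Comparing characteristic polynomials says that the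
    convolution square of f on the roots of unity is n f, which forces f to be constant. In
    characteristic p a p-primary R has the single eigenvalue 1 and this says nothing; there the rank
    of the norm 1 + R + ... + R^(m-1) is compared instead. This dichotomy is why R is cut into
    primary parts. Both cases use that the minimal polynomial of R is exactly X^m - 1. The
    independence behind it is Dedekind's: powers of g are characters of the dual algebra,
    convolution powers of nu are characters of A. Radford's formula starts from a nonzero left
    integral, obtained as an explicit trace; nondegeneracy, uniqueness and bijectivity of S are
    drawn from it. Constants: the square of the antipode of A restricts to S_(alpha^-1) S_alpha on
    H_alpha, so the exponent 4 dim A halves to 2 dim A = 2 d dim H_1. For d = 2 that map is the
    square of S_alpha, whence 8 = 2 * 2 * 2. *)

Section LinearMaps.

Variable k : fieldType.
Implicit Types U V W X Y : lmodType k.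

Definition trilinear_map (U V W : vectType k) X (t : U -> V -> W -> X) : Prop :=
  [/\ forall v w, linear (fun u => t u v w), forall u w, linear (fun v => t u v w)
    & forall u v, linear (t u v)].

Lemma linear_id U : linear (fun x : U => x).
Proof. by []. Qed.

Lemma linear_app U V W (f : {linear V -> W}) (g : U -> V) :
  linear g -> linear (fun x => f (g x)).
Proof. by move=> gl c x y; rewrite gl linearP. Qed.

Lemma linear_fun_app U V W (f : V -> W) (g : U -> V) :
  linear f -> linear g -> linear (fun x => f (g x)).
Proof. by move=> fl gl c x y; rewrite gl fl. Qed.

Lemma linear_scaler U V (c : k) (g : U -> V) :
  linear g -> linear (fun x => c *: g x).
Proof. by move=> gl d x y; rewrite gl scalerDr !scalerA mulrC. Qed.

Lemma linear_scalel U V (f : U -> k^o) (v : V) :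
  linear f -> linear (fun x => (f x : k) *: v).
Proof. by move=> fl d x y; rewrite fl scalerDl -scalerA. Qed.

Lemma linear_sum_fun U V (I : Type) (r : seq I) (P : pred I) (F : I -> U -> V) :
  (forall i, linear (F i)) -> linear (fun x => \sum_(i <- r | P i) F i x).
Proof.
move=> Fl c x y; rewrite scaler_sumr -big_split /=.
by apply: eq_bigr => i _; rewrite Fl.
Qed.

Lemma linear_bil_l U (V W : vectType k) X (b : V -> W -> X) (g : U -> V) w :
  bilinear_map b -> linear g -> linear (fun x => b (g x) w).
Proof. by case=> bl _ gl c x y; rewrite gl bl. Qed.

Lemma linear_bil_r U (V W : vectType k) X (b : V -> W -> X) (g : U -> W) v :
  bilinear_map b -> linear g -> linear (fun x => b v (g x)).
Proof. by case=> _ br gl c x y; rewrite gl br. Qed.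

Lemma linear_tri1 U (V W X : vectType k) Y (t : V -> W -> X -> Y) (g : U -> V) w x :
  trilinear_map t -> linear g -> linear (fun z => t (g z) w x).
Proof. by case=> t1 _ _ gl c y z; rewrite gl t1. Qed.

Lemma linear_tri2 U (V W X : vectType k) Y (t : V -> W -> X -> Y) (g : U -> W) v x :
  trilinear_map t -> linear g -> linear (fun z => t v (g z) x).
Proof. by case=> _ t2 _ gl c y z; rewrite gl t2. Qed.

Lemma linear_tri3 U (V W X : vectType k) Y (t : V -> W -> X -> Y) (g : U -> X) v w :
  trilinear_map t -> linear g -> linear (fun z => t v w (g z)).
Proof. by case=> _ _ t3 gl c y z; rewrite gl t3. Qed.

Lemma linear_zero U V (f : U -> V) : linear f -> f 0 = 0.
Proof. by move=> fl; have := fl (-1) 0 0; rewrite scaler0 addr0 scaleN1r addNr. Qed.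

Lemma linear_scale U V (f : U -> V) c x : linear f -> f (c *: x) = c *: f x.
Proof. by move=> fl; have := fl c x 0; rewrite !addr0 (linear_zero fl) addr0. Qed.

Lemma linear_bigsum U V (f : U -> V) (I : Type) (r : seq I) (P : pred I) F :
  linear f -> f (\sum_(i <- r | P i) F i) = \sum_(i <- r | P i) f (F i).
Proof.
move=> fl; apply: (big_morph f) => [x y|]; last exact: linear_zero.
by have := fl 1 x y; rewrite !scale1r.
Qed.

End LinearMaps.

Section TensorLift.

Variable k : fieldType.
Implicit Types (U V W : vectType k) (X Y : lmodType k).

Lemma eq_tlift V W X (b b' : V -> W -> X) t :
  (forall v w, b v w = b' v w) -> tlift b t = tlift b' t.
Proof.
by move=> bb'; apply: eq_bigr => i _; apply: eq_bigr => j _; rewrite bb'.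
Qed.

Lemma linear_tlift_arg V W X Y (b : V -> W -> Y) (g : X -> tensor V W) :
  linear g -> linear (fun x => tlift b (g x)).
Proof. by move=> gl c x y; rewrite gl linearP. Qed.

Lemma linear_tlift_fun V W X Y (B : X -> V -> W -> Y) t :
  (forall v w, linear (fun x => B x v w)) -> linear (fun x => tlift (B x) t).
Proof.
move=> Bl; apply: linear_sum_fun => i; apply: linear_sum_fun => j.
exact/linear_scaler/Bl.
Qed.

(** Holds for an arbitrary [b], bilinear or not: [tlift] is an explicit finite sum over basis
    vectors, through which a linear [f] passes termwise. *)
Lemma tlift_app V W X Y (f : X -> Y) (b : V -> W -> X) t :
  linear f -> f (tlift b t) = tlift (fun v w => f (b v w)) t.
Proof.
move=> fl; rewrite /tlift (linear_bigsum _ _ _ fl).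
apply: eq_bigr => i _; rewrite (linear_bigsum _ _ _ fl); apply: eq_bigr => j _.
exact: linear_scale.
Qed.

(** Fubini for two independent Sweedler sums. *)
Lemma tlift_exch V W V' W' X (B : V -> W -> V' -> W' -> X) t s :
  tlift (fun v w => tlift (fun v' w' => B v w v' w') s) t =
  tlift (fun v' w' => tlift (fun v w => B v w v' w') t) s.
Proof.
have tliftE V0 W0 (b : V0 -> W0 -> X) (r : tensor V0 W0) :
    tlift b r = \sum_p r p.1 p.2 *: b (vbasis {:V0})`_p.1 (vbasis {:W0})`_p.2.
  by rewrite /tlift pair_bigA.
rewrite !tliftE.
under eq_bigr => p _ do rewrite tliftE scaler_sumr.
under [RHS]eq_bigr => p _ do rewrite tliftE scaler_sumr.
rewrite exchange_big /=; apply: eq_bigr => p _; apply: eq_bigr => q _.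
by rewrite !scalerA mulrC.
Qed.

Lemma tlift_sum V W X (I : Type) (r : seq I) (P : pred I)
    (B : I -> V -> W -> X) t :
  tlift (fun v w => \sum_(i <- r | P i) B i v w) t =
  \sum_(i <- r | P i) tlift (B i) t.
Proof.
rewrite /tlift [RHS]exchange_big /=; apply: eq_bigr => i _.
rewrite exchange_big /=; apply: eq_bigr => j _; exact: scaler_sumr.
Qed.

Lemma tliftB V W X (b c : V -> W -> X) t :
  tlift (fun u v => b u v - c u v) t = tlift b t - tlift c t.
Proof.
rewrite /tlift -sumrB; apply: eq_bigr => i _; rewrite -sumrB.
by apply: eq_bigr => j _; rewrite scalerBr.
Qed.

Lemma tlift_eq0 V W X (b : V -> W -> X) t : (forall v w, b v w = 0) -> tlift b t = 0.
Proof.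
by move=> b0; rewrite /tlift big1 // => i _; rewrite big1 // => j _; rewrite b0 scaler0.
Qed.

Lemma tlift_tmap V W V' W' X (b : V' -> W' -> X) (f : V -> V') (g : W -> W') t :
  bilinear_map b -> linear f -> linear g ->
  tlift b (tmap f g t) = tlift (fun v w => b (f v) (g w)) t.
Proof.
move=> bb fl gl; rewrite /tmap tlift_app; last exact: tlift_linear.
by apply: eq_tlift => v w; rewrite tlift_pure.
Qed.

Lemma tlift_tpure V W (t : tensor V W) : tlift (@tpure k V W) t = t.
Proof. by rewrite [RHS]tensor_decomp. Qed.

End TensorLift.

(** Sweedler expressions are built from linear operations, so linearity in a variable is found by
    peeling off the outermost one. The generic [linear_app] is tried last. *)
Ltac lin_step :=
  intros; cbv beta;
  first
  [ assumption
  | match goal with |- bilinear_map _ => split end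
  | match goal with |- trilinear_map _ => split end
  | exact: linear_id
  | apply: linear_scaler | apply: linear_scalel
  | apply: linear_tlift_arg | apply: linear_tlift_fun
  | match goal with H : bilinear_map ?b |- _ =>
       first [ apply: (linear_bil_l _ H) | apply: (linear_bil_r _ H) ] end
  | match goal with H : trilinear_map ?b |- _ =>
       first [ apply: (linear_tri1 _ _ H) | apply: (linear_tri2 _ _ H)
             | apply: (linear_tri3 _ _ H) ] end
  | apply: (linear_bil_l _ (alg_mul_bilinear _))
  | apply: (linear_bil_r _ (alg_mul_bilinear _))
  | apply: (linear_bil_l _ (tpure_bilinear _ _))
  | apply: (linear_bil_r _ (tpure_bilinear _ _))
  | match goal with H : GRing.linear_for _ ?b |- _ => apply: (linear_fun_app H) end
  | apply: linear_sum_fun | apply: linear_app ].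
Ltac lin := solve [repeat lin_step].

(** * Integrals and Radford's formula *)

(* Sweedler notation: [tlift (fun u v => b u v) (ha_comul A x)] is b(x_1, x_2). *)
Record hopfAlgebra (k : fieldType) := HopfAlgebra {
  ha_space :> vectType k;
  ha_alg : algebra_on ha_space;
  ha_comul : {linear ha_space -> tensor ha_space ha_space};
  ha_counit : {linear ha_space -> k^o};
  ha_antipode : {linear ha_space -> ha_space};
  ha_coassoc : forall (X : lmodType k) (t : ha_space -> ha_space -> ha_space -> X) x,
    trilinear_map t ->
    tlift (fun u v => tlift (fun a b => t a b v) (ha_comul u)) (ha_comul x) =
    tlift (fun u v => tlift (fun a b => t u a b) (ha_comul v)) (ha_comul x);
  ha_counitl : forall x,
    tlift (fun u v => (ha_counit u : k) *: v) (ha_comul x) = x;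
  ha_counitr : forall x,
    tlift (fun u v => (ha_counit v : k) *: u) (ha_comul x) = x;
  ha_comul1 : ha_comul (alg_one ha_alg) = tpure (alg_one ha_alg) (alg_one ha_alg);
  ha_comulM : forall x y, ha_comul (alg_mul ha_alg x y) =
    tmul ha_alg ha_alg (ha_comul x) (ha_comul y);
  ha_counit1 : ha_counit (alg_one ha_alg) = 1;
  ha_counitM : forall x y,
    ha_counit (alg_mul ha_alg x y) = (ha_counit x : k) * (ha_counit y : k);
  ha_antipodel : forall x,
    tlift (fun u v => alg_mul ha_alg (ha_antipode u) v) (ha_comul x) =
    (ha_counit x : k) *: alg_one ha_alg;
  ha_antipoder : forall x,
    tlift (fun u v => alg_mul ha_alg u (ha_antipode v)) (ha_comul x) =
    (ha_counit x : k) *: alg_one ha_alg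
}.

Section HopfTheory.

Variables (k : fieldType) (A : hopfAlgebra k).
Implicit Types (x y z h u v : A) (X : lmodType k).

Local Notation "x ** y" := (alg_mul (ha_alg A) x y) (at level 40, left associativity).
Local Notation "1_A" := (alg_one (ha_alg A)).
Local Notation S := (ha_antipode A).
Local Notation eps := (ha_counit A).
Local Notation D := (ha_comul A).

Lemma hmulA x y z : x ** (y ** z) = x ** y ** z. Proof. exact: alg_mulA. Qed.
Lemma hmul1l x : 1_A ** x = x. Proof. exact: alg_mul1l. Qed.
Lemma hmul1r x : x ** 1_A = x. Proof. exact: alg_mul1r. Qed.

Lemma hmulZl c x y : (c *: x) ** y = c *: (x ** y).
Proof. by apply: (linear_scale _ _ (f := fun z => z ** y)); lin. Qed.

Lemma hmulZr c x y : x ** (c *: y) = c *: (x ** y).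
Proof. by apply: (linear_scale _ _ (f := fun z => x ** z)); lin. Qed.

(** The Sweedler rules carry a linear [f], the context of the rewriting, so that counits and
    antipodes can be inserted or cancelled deep inside an expression. *)
Lemma counitl_app X (f : A -> X) x : linear f ->
  tlift (fun u v => (eps u : k) *: f v) (D x) = f x.
Proof.
move=> fl; rewrite -[in RHS](ha_counitl x) tlift_app //.
by apply: eq_tlift => u v; rewrite (linear_scale _ _ fl).
Qed.

Lemma counitr_app X (f : A -> X) x : linear f ->
  tlift (fun u v => (eps v : k) *: f u) (D x) = f x.
Proof.
move=> fl; rewrite -[in RHS](ha_counitr x) tlift_app //.
by apply: eq_tlift => u v; rewrite (linear_scale _ _ fl).
Qed.

Lemma antipodel_app X (f : A -> X) x : linear f ->
  tlift (fun u v => f (S u ** v)) (D x) = (eps x : k) *: f 1_A.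
Proof. by move=> fl; rewrite -(linear_scale _ _ fl) -ha_antipodel tlift_app. Qed.

Lemma antipoder_app X (f : A -> X) x : linear f ->
  tlift (fun u v => f (u ** S v)) (D x) = (eps x : k) *: f 1_A.
Proof. by move=> fl; rewrite -(linear_scale _ _ fl) -ha_antipoder tlift_app. Qed.

Lemma sweedler1 X (b : A -> A -> X) : bilinear_map b ->
  tlift b (D 1_A) = b 1_A 1_A.
Proof. by move=> bb; rewrite ha_comul1 tlift_pure. Qed.

Lemma tlift_tmul X (b : A -> A -> X) (s t : tensor A A) : bilinear_map b ->
  tlift b (tmul (ha_alg A) (ha_alg A) s t) =
  tlift (fun p q => tlift (fun u v => b (p ** u) (q ** v)) t) s.
Proof.
move=> bb; rewrite /tmul tlift_app; last exact: tlift_linear.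
apply: eq_tlift => p q; rewrite tlift_app; last exact: tlift_linear.
by apply: eq_tlift => u v; rewrite tlift_pure.
Qed.

Lemma sweedlerM X (b : A -> A -> X) x y : bilinear_map b ->
  tlift b (D (x ** y)) =
  tlift (fun p q => tlift (fun u v => b (p ** u) (q ** v)) (D y)) (D x).
Proof. by move=> bb; rewrite ha_comulM tlift_tmul. Qed.

Lemma antipode1 : S 1_A = 1_A.
Proof.
have := ha_antipodel (1_A : A); rewrite sweedler1; last by lin.
by rewrite hmul1r ha_counit1 scale1r.
Qed.

Lemma antipoder_app2 X (f : A -> X) x y : linear f ->
  tlift (fun a b => tlift (fun c d => f (a ** c ** (S d ** S b))) (D y)) (D x) =
  (eps x : k) *: ((eps y : k) *: f 1_A).
Proof.
move=> fl.
transitivity (tlift (fun a b => (eps y : k) *: f (a ** S b)) (D x)).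
  apply: eq_tlift => a b.
  transitivity (tlift (fun c d => f (a ** (c ** S d) ** S b)) (D y)).
    by apply: eq_tlift => c d; rewrite !hmulA.
  by rewrite (antipoder_app (f := fun z => f (a ** z ** S b))) ?hmul1r //; lin.
by rewrite (antipoder_app (f := fun z => (eps y : k) *: f z)) //; lin.
Qed.

Lemma antipodel_app2 X (f : A -> X) x y : linear f ->
  tlift (fun a b => tlift (fun c d => f (S (a ** c) ** (b ** d))) (D y)) (D x) =
  (eps x : k) *: ((eps y : k) *: f 1_A).
Proof.
move=> fl; rewrite scalerA -ha_counitM -antipodel_app // sweedlerM //; lin.
Qed.

Lemma antipodeM x y : S (x ** y) = S y ** S x.
Proof.
(* both sides equal S(x_1 y_1) x_2 y_2 S(y_3) S(x_3) *)
pose T u v w p q r := S (u ** p) ** (v ** q) ** (S r ** S w).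
transitivity (tlift (fun u v => tlift (fun a b => tlift (fun p q =>
    tlift (fun c d => T u a b p c d) (D q)) (D y)) (D v)) (D x)).
  rewrite -(counitr_app (f := fun x => S (x ** y))); last by lin.
  apply: eq_tlift => u v; rewrite tlift_exch.
  rewrite -(counitr_app (f := fun y => S (u ** y))); last by lin.
  rewrite -(linear_scale _ _ (f := fun z => z)) // tlift_app; last by lin.
  apply: eq_tlift => p q; rewrite /T.
  transitivity (tlift (fun a b => tlift (fun c d =>
      S (u ** p) ** (a ** c ** (S d ** S b))) (D q)) (D v)).
    by rewrite (antipoder_app2 (f := fun z => S (u ** p) ** z)) ?hmul1r //; lin.
  by apply: eq_tlift => a b; apply: eq_tlift => c d; rewrite !hmulA.
rewrite -ha_coassoc; last by rewrite /T; lin.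
rewrite -(counitl_app (f := fun x => S y ** S x)); last by lin.
apply: eq_tlift => u v.
transitivity (tlift (fun a b => tlift (fun p q => tlift (fun c d => T a b v c d q)
    (D p)) (D y)) (D u)).
  by apply: eq_tlift => a b; rewrite ha_coassoc //; rewrite /T; lin.
rewrite tlift_exch -(counitl_app (f := fun y => S y ** S v)); last by lin.
rewrite tlift_app; last by lin.
apply: eq_tlift => p q; rewrite /T.
transitivity (tlift (fun a b => tlift (fun c d =>
    S (a ** c) ** (b ** d) ** (S q ** S v)) (D p)) (D u)) => //.
by rewrite (antipodel_app2 (f := fun z => z ** (S q ** S v))) ?hmul1l //; lin.
Qed.

Definition left_integral (L : A) : Prop := forall h, h ** L = (eps h : k) *: L.

Local Notation E := (vbasis {:A}).
Local Notation N := (\dim {:A}).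

Lemma sum_coord_vbasis x : \sum_(i < N) coord E i x *: E`_i = x.
Proof. by rewrite -coord_vbasis // memvf. Qed.

(** Cyclicity of the trace: sum_i t(e_i) (x) e^i and sum_i e_i (x) e^i t are the same element, as
    expanding [t] in coordinates on either side shows. *)
Lemma trace_cycle (w t : A -> A) : linear w -> linear t ->
  \sum_(i < N) tlift (fun a b => coord E i (w b) *: a) (D (t E`_i)) =
  \sum_(i < N) tlift (fun a b => coord E i (t (w b)) *: a) (D E`_i).
Proof.
move=> wl tl.
transitivity (\sum_(i < N) \sum_(j < N) tlift (fun a b =>
    coord E j (t E`_i) *: (coord E i (w b) *: a)) (D E`_j)).
  apply: eq_bigr => i _; rewrite -[in LHS](sum_coord_vbasis (t _)).
  rewrite linear_sum linear_sum; apply: eq_bigr => j _.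
  by rewrite !linearZ /= tlift_app //; lin.
rewrite exchange_big; apply: eq_bigr => j _ /=.
rewrite -tlift_sum; apply: eq_tlift => a b.
rewrite -[in RHS](sum_coord_vbasis (w b)) (linear_bigsum _ _ _ tl) linear_sum.
rewrite scaler_suml; apply: eq_bigr => i _.
rewrite scalerA (linear_scale _ _ tl) linearZ; congr (_ *: a); exact: mulrC.
Qed.

Lemma antipode_antipode2_app X (f : A -> X) x : linear f ->
  tlift (fun u v => f (S v ** S (S u))) (D x) = (eps x : k) *: f 1_A.
Proof.
move=> fl; transitivity (tlift (fun u v => f (S (S u ** v))) (D x)).
  by apply: eq_tlift => u v; rewrite antipodeM.
by rewrite (antipodel_app (f := fun z => f (S z))) ?antipode1 //; lin.
Qed.

Lemma antipode2_antipode_app X (f : A -> X) x : linear f ->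
  tlift (fun u v => f (S (S v) ** S u)) (D x) = (eps x : k) *: f 1_A.
Proof.
move=> fl; transitivity (tlift (fun u v => f (S (u ** S v))) (D x)).
  by apply: eq_tlift => u v; rewrite antipodeM.
by rewrite (antipoder_app (f := fun z => f (S z))) ?antipode1 //; lin.
Qed.

(* The A-invariant coevaluation sum_i e_i (x) e^i, for A acting on the dual by
   (h f)(z) = f(S(h) z), untwisted by x (x) f |-> x_1 (x) S(x_2) f and evaluated at y. *)
Definition trace_integral y :=
  \sum_(i < N) tlift (fun a b => coord E i (S (S b) ** y) *: a) (D E`_i).

(** Write Delta(e_i) = a (x) b. Inserting S(h_3) S^2(h_2) turns h a e^i(S^2(b) y) into (h_1 e_i)_1
    e^i(S(h_2) S^2((h_1 e_i)_2) y). Moving h_1 around the trace by [trace_cycle] leaves h_1 S(h_2),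
    that is, the counit of h. *)
Lemma trace_integralP y : left_integral (trace_integral y).
Proof.
move=> h; rewrite /trace_integral.
rewrite (linear_bigsum _ _ _ (f := fun z => h ** z)); last by lin.
transitivity (\sum_(i < N) tlift (fun h1 h2 => tlift (fun a b =>
    coord E i (S h2 ** S (S b) ** y) *: a) (D (h1 ** E`_i))) (D h)).
  apply: eq_bigr => i _; rewrite tlift_app; last by lin.
  rewrite -(counitr_app (f := fun h => tlift (fun a b =>
    h ** (coord E i (S (S b) ** y) *: a)) (D E`_i))); last by lin.
  transitivity (tlift (fun p v => tlift (fun q r => tlift (fun a b =>
      coord E i (S r ** S (S (q ** b)) ** y) *: (p ** a)) (D E`_i)) (D v)) (D h)).
    apply: eq_tlift => p v; rewrite tlift_exch tlift_app; last by lin.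
    apply: eq_tlift => a b.
    transitivity (tlift (fun q r =>
        coord E i ((S r ** S (S q)) ** S (S b) ** y) *: (p ** a)) (D v)).
      rewrite (antipode_antipode2_app (f := fun z =>
        coord E i (z ** S (S b) ** y) *: (p ** a))); last by lin.
      by rewrite hmul1l hmulZr.
    by apply: eq_tlift => q r; rewrite !antipodeM !hmulA.
  rewrite -ha_coassoc; last by lin.
  apply: eq_tlift => h1 h2.
  by rewrite (sweedlerM (b := fun a b =>
    coord E i (S h2 ** S (S b) ** y) *: a)) //; lin.
rewrite -tlift_sum.
transitivity (tlift (fun h1 h2 => \sum_(i < N) tlift (fun a b =>
    coord E i (h1 ** (S h2 ** S (S b) ** y)) *: a) (D E`_i)) (D h)).
  apply: eq_tlift => h1 h2.
  by rewrite (trace_cycle (w := fun b => S h2 ** S (S b) ** y)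
    (t := fun z => h1 ** z)) //; lin.
rewrite tlift_sum scaler_sumr; apply: eq_bigr => i _.
rewrite tlift_exch tlift_app; last by lin.
apply: eq_tlift => a b.
transitivity (tlift (fun h1 h2 => coord E i ((h1 ** S h2) ** S (S b) ** y) *: a) (D h)).
  by apply: eq_tlift => h1 h2; rewrite !hmulA.
rewrite (antipoder_app (f := fun z => coord E i (z ** S (S b) ** y) *: a)) ?hmul1l //;
  lin.
Qed.
Lemma alg1_neq0 : 1_A != 0.
Proof.
apply/eqP => e1; have := ha_counit1 A; rewrite e1 linear0 => /esym/eqP.
by rewrite (negPf (oner_neq0 _)).
Qed.

(** The twist can be undone: y is the sum over j of [G j] applied to the trace integral of e_j,
    because S^2(s) S(r) collapses to the counit. If all these integrals vanished, so would y = 1. *)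
Lemma exists_integral : exists2 L, left_integral L & L != 0.
Proof.
have [/existsP[j nz] | /existsPn z0] :=
  boolP [exists j : 'I_N, trace_integral E`_j != 0].
  by exists (trace_integral E`_j) => //; apply: trace_integralP.
case/eqP: alg1_neq0; move: (1_A) => y.
pose G (j : 'I_N) u := tlift (fun p r => coord E j (S r ** y) *: p) (D u).
have Gl j : linear (G j) by rewrite /G; lin.
transitivity (\sum_(j < N) G j (trace_integral E`_j)); last first.
  by rewrite big1 // => j _; have /negPn/eqP-> := z0 j; rewrite (linear_zero (Gl j)).
under eq_bigr => j _ do rewrite /trace_integral (linear_bigsum _ _ _ (Gl j)).
rewrite exchange_big -[LHS](sum_coord_vbasis y); apply: eq_bigr => i _ /=.
rewrite -(counitr_app (f := fun p => coord E i y *: p)); last by lin.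
transitivity (tlift (fun p q => tlift (fun r s =>
    coord E i (S (S s) ** S r ** y) *: p) (D q)) (D E`_i)).
  apply: eq_tlift => p q.
  by rewrite (antipode2_antipode_app (f := fun z => coord E i (z ** y) *: p)) ?hmul1l
    //; lin.
rewrite -ha_coassoc; last by lin.
under [RHS]eq_bigr => j _ do rewrite tlift_app //.
rewrite -tlift_sum; apply: eq_tlift => u v.
transitivity (tlift (fun p r => \sum_(j < N) coord E i (S (S v) ** E`_j) *:
  (coord E j (S r ** y) *: p)) (D u)).
  apply: eq_tlift => p r.
  rewrite -hmulA -[in LHS](sum_coord_vbasis (S r ** y)).
  rewrite (linear_bigsum _ _ _ (f := fun z => coord E i (S (S v) ** z) *: p));
    last by lin.
  by apply: eq_bigr => j _; rewrite hmulZr linearZ scalerA mulrC.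
rewrite tlift_sum; apply: eq_bigr => j _.
by rewrite (linear_scale _ _ (Gl j)) /G
  (tlift_app (f := fun z => coord E i (S (S v) ** E`_j) *: z)) //; lin.
Qed.

(** L_1 (x) h L_2 = S(h_1) h_2 L_1 (x) h_3 L_2, and the last two legs of h act on Delta(L) through
    the counit, L being a left integral. *)
Lemma integral_move X (b : A -> A -> X) (L h : A) : left_integral L ->
  bilinear_map b ->
  tlift (fun u v => b u (h ** v)) (D L) = tlift (fun u v => b (S h ** u) v) (D L).
Proof.
move=> Li bb.
transitivity (tlift (fun p q => tlift (fun r s => tlift (fun u v =>
    b (S p ** (r ** u)) (s ** v)) (D L)) (D q)) (D h)).
  rewrite -ha_coassoc; last by lin.
  rewrite -(counitl_app (f := fun h => tlift (fun u v => b u (h ** v)) (D L)));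
    last by lin.
  apply: eq_tlift => p q.
  rewrite tlift_exch tlift_app; last by lin.
  apply: eq_tlift => u v.
  transitivity (tlift (fun r s => b (S r ** s ** u) (q ** v)) (D p)).
    by rewrite (antipodel_app (f := fun z => b (z ** u) (q ** v))) ?hmul1l //; lin.
  by apply: eq_tlift => r s; rewrite hmulA.
transitivity (tlift (fun p q => (eps q : k) *:
  tlift (fun u v => b (S p ** u) v) (D L)) (D h)).
  apply: eq_tlift => p q.
  have <- := sweedlerM (b := fun u v => b (S p ** u) v) q L ltac:(lin).
  by rewrite Li !linearZ.
by rewrite (counitr_app (f := fun p => tlift (fun u v => b (S p ** u) v) (D L))) //;
  lin.
Qed.


(** * Nondegeneracy and uniqueness of a nonzero left integral *)

Section Integral.

Variable L : A.
Hypotheses (Li : left_integral L) (L0 : L != 0).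

(** By [integral_move], the kernel of f |-> L_1 f(L_2) is stable under replacing f by f(z _). Then
    f(y) L = L_1 f(y S(L_2) L_3), expanded along the coordinates of y S(L_2), is a sum of images of
    vanishing terms, and L is nonzero. *)
Lemma integral_nondeg (f : A -> k^o) : linear f ->
  tlift (fun u v => (f v : k) *: u) (D L) = 0 -> forall y, f y = 0.
Proof.
move=> fl f0 y.
have fz z : tlift (fun u v => (f (z ** v) : k) *: u) (D L) = 0.
  rewrite (integral_move (b := fun u v => (f v : k) *: u)) //; last by lin.
  rewrite -(linear_zero (f := fun u => S z ** u)); last by lin.
  by rewrite -f0 tlift_app; [apply: eq_tlift => u v; rewrite hmulZr | lin].
suff /eqP: (f y : k) *: L = 0.
  by rewrite scaler_eq0 (negPf L0) orbF => /eqP.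
pose G (j : 'I_N) w := tlift (fun u r => coord E j (y ** S r) *: u) (D w).
have Gl j : linear (G j) by rewrite /G; lin.
transitivity (\sum_(j < N) G j 0); last first.
  by rewrite big1 // => j _; rewrite (linear_zero (Gl j)).
rewrite -(counitr_app (f := fun u => (f y : k) *: u)); last by lin.
transitivity (tlift (fun u v => tlift (fun r s =>
    (f (y ** S r ** s) : k) *: u) (D v)) (D L)).
  apply: eq_tlift => u v.
  transitivity (tlift (fun r s => (f (y ** (S r ** s)) : k) *: u) (D v)).
    by rewrite (antipodel_app (f := fun z => (f (y ** z) : k) *: u)) ?hmul1r //; lin.
  by apply: eq_tlift => r s; rewrite hmulA.
rewrite -ha_coassoc; last by lin.
under [RHS]eq_bigr => j _ do rewrite -(fz E`_j) tlift_app //.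
rewrite -tlift_sum; apply: eq_tlift => w v.
rewrite /G.
transitivity (tlift (fun u r => \sum_(j < N) (f (E`_j ** v) : k) *:
  (coord E j (y ** S r) *: u)) (D w)).
  apply: eq_tlift => u r.
  rewrite -[in LHS](sum_coord_vbasis (y ** S r)).
  rewrite (linear_bigsum _ _ _ (f := fun z => (f (z ** v) : k) *: u)); last by lin.
  by apply: eq_bigr => j _; rewrite hmulZl (linear_scale _ _ fl) scalerA mulrC.
rewrite tlift_sum; apply: eq_bigr => j _.
rewrite -/(G j _) (linear_scale _ _ (Gl j)) /G.
by rewrite (tlift_app (f := fun z => (f (E`_j ** v) : k) *: z)) //; lin.
Qed.

Lemma integral_surj x : exists2 f : A -> k^o, linear f &
  tlift (fun u v => (f v : k) *: u) (D L) = x.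
Proof.
(* A tensor is its coordinate matrix, so [D L] is itself the matrix of f |-> L_1 f(L_2);
   [integral_nondeg] makes it invertible. *)
pose M : 'M[k]_N := D L.
pose F (c : 'cV[k]_N) (v : A) : k^o := \sum_(j < N) c j 0 * coord E j v.
have Fl c : linear (F c) by apply: linear_sum_fun => j a u v;
  rewrite linearP mulrDr mulrCA.
have FE c : tlift (fun u v => (F c v : k) *: u) (D L) = \sum_(i < N) (M *m c) i 0 *:
  E`_i.
  apply: eq_bigr => i _; rewrite mxE scaler_suml; apply: eq_bigr => j _.
  rewrite scalerA; congr (M i j * _ *: _).
  rewrite /F (bigD1 j) //= big1 ?addr0 => [|j' nj].
    by rewrite coord_free ?(basis_free (vbasisP _)) // eqxx mulr1.
  by rewrite coord_free ?(basis_free (vbasisP _)) // eq_sym (negPf nj) mulr0.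
have Mu : M \in unitmx.
  rewrite -unitmx_tr -row_free_unit -kermx_eq0; apply/eqP/row_matrixP => i.
  rewrite row0; set c := row i _.
  have : M *m c^T = 0.
    by apply: trmx_inj; rewrite trmx_mul trmxK /c -row_mul mulmx_ker row0 trmx0.
  move=> Mc; have {}Mc : forall y, F c^T y = 0.
    by apply: integral_nondeg => //; rewrite FE Mc big1 // => j _; rewrite mxE scale0r.
  apply/rowP => j; rewrite [RHS]mxE -[RHS](Mc E`_j) /F (bigD1 j) //= big1 ?addr0 =>
    [|j' nj].
    by rewrite coord_free ?(basis_free (vbasisP _)) // eqxx mulr1 !mxE.
  by rewrite coord_free ?(basis_free (vbasisP _)) // eq_sym (negPf nj) mulr0.
exists (F (invmx M *m \col_i coord E i x)) => //.
rewrite FE mulKVmx // -[RHS](sum_coord_vbasis x).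
by apply: eq_bigr => i _; rewrite mxE.
Qed.

Lemma counit_antipode x : eps (S x) = eps x.
Proof.
transitivity (eps (tlift (fun u v => S u ** v) (D x))); last first.
  by rewrite ha_antipodel linearZ /= ha_counit1; apply: mulr1.
rewrite -(counitr_app (f := fun z => eps (S z))); last by lin.
rewrite (tlift_app (f := eps)); last by lin.
by apply: eq_tlift => u v; rewrite ha_counitM mulrC.
Qed.

Lemma tlift_integral_mul (f : A -> k^o) h : linear f ->
  tlift (fun u v => (f (h ** v) : k) *: u) (D L) =
  S h ** tlift (fun u v => (f v : k) *: u) (D L).
Proof.
move=> fl; rewrite (integral_move (b := fun u v => (f v : k) *: u)) //; last by lin.
rewrite (tlift_app (f := fun z => S h ** z)); last by lin.
by apply: eq_tlift => u v; rewrite hmulZr.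
Qed.

Lemma integral_nondeg2 (f f' : A -> k^o) : linear f -> linear f' ->
  tlift (fun u v => (f v : k) *: u) (D L) = tlift (fun u v => (f' v : k) *: u) (D L) ->
  forall y, f y = f' y.
Proof.
move=> fl f'l ff' y; apply/eqP; rewrite -subr_eq0; apply/eqP.
apply: (integral_nondeg (f := fun y => f y - f' y)).
  by move=> c u v; rewrite fl f'l scalerBr opprD addrACA.
transitivity (tlift (fun u v => (f v : k) *: u - (f' v : k) *: u) (D L)).
  by apply: eq_tlift => u v; rewrite scalerBl.
by rewrite tliftB ff' subrr.
Qed.

(** Write L' = L_1 f(L_2). By nondegeneracy, S(h) L' = eps(h) L' reads f(h y) = eps(h) f(y); hence f
    = f(1) eps and L' = f(1) L. *)
Lemma integral_uniq L' : left_integral L' -> exists c : k, L' = c *: L.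
Proof.
move=> Li'; have [f fl fL] := integral_surj L'.
have fh h y : f (h ** y) = (eps h : k) *: f y.
  apply: (integral_nondeg2 (f := fun y => f (h ** y))
    (f' := fun y => (eps h : k) *: f y)); [lin | lin |].
  rewrite tlift_integral_mul // fL Li' counit_antipode.
  rewrite -fL (tlift_app (f := fun z => (eps h : k) *: z)); last by lin.
  by apply: eq_tlift => u v; rewrite scalerA.
exists (f 1_A); rewrite -fL -(counitr_app (f := fun z => (f 1_A : k) *: z));
  last by lin.
by apply: eq_tlift => u v; rewrite -[in LHS](hmul1r v) fh scalerA.
Qed.

(** S(h) L_1 f(L_2) = L_1 f(h L_2), so S(h) = 0 forces f(h) = 0 for every coordinate functional
    f. *)
Lemma antipode_inj : injective S.
Proof.
move=> x y exy; apply/eqP; rewrite -subr_eq0; apply/eqP; set h := x - y.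
have Sh : S h = 0 by rewrite linearB /= exy subrr.
rewrite -(sum_coord_vbasis h) big1 // => i _.
suff -> : coord E i h = 0 by rewrite scale0r.
rewrite -[h]hmul1r.
apply: (integral_nondeg (f := fun y => coord E i (h ** y))); first by lin.
rewrite (tlift_integral_mul (f := fun y => coord E i y)) ?Sh; last by lin.
by rewrite (linear_zero (f := fun z => z ** _)) //; lin.
Qed.

Lemma antipode_bij : exists Si : {linear A -> A}, cancel S Si /\ cancel Si S.
Proof.
pose Sf : 'End(A) := linfun S.
have kS : lker Sf == 0%VS.
  by apply/lker0P => x y; rewrite !lfunE; apply: antipode_inj.
exists (Sf^-1)%VF; split=> x.
  by have := lker0_lfunK kS x; rewrite lfunE.
by have := lker0_lfunVK kS x; rewrite lfunE.
Qed.

(** * The cointegral, the distinguished grouplike element and the modular character *)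

Section Cointegral.

Variable lam : A -> k^o.
Hypotheses (laml : linear lam)
  (lamL : tlift (fun u v => (lam v : k) *: u) (D L) = 1_A).

(** Nondegeneracy reduces an identity of functionals in x to its value at x = L_2, next to L_1.
    There L_1 (x) L_2 lam(L_3) = Delta(1) = 1 (x) 1 agrees with L_1 lam(L_2) (x) 1. *)
Lemma cointegralP x : tlift (fun u v => (lam v : k) *: u) (D x) = (lam x : k) *: 1_A.
Proof.
apply/eqP; rewrite -subr_eq0; apply/eqP; set M := _ - _.
rewrite -(sum_coord_vbasis M) big1 // => i _; rewrite /M linearB linearZ /=.
set d := _ - _; suff -> : d = 0 by rewrite scale0r.
apply/eqP; rewrite subr_eq0; apply/eqP.
apply: (integral_nondeg2
  (f := fun x => coord E i (tlift (fun u v => (lam v : k) *: u) (D x)))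
  (f' := fun x => (lam x : k) *: (coord E i 1_A : k^o))); [lin | lin |].
transitivity ((coord E i 1_A : k) *: 1_A).
  rewrite -(counitr_app (f := fun z => coord E i z *: 1_A)) ; last by lin.
  rewrite ha_comul1 tlift_pure; last by lin.
  rewrite ha_counit1 scale1r.
  transitivity (tlift (fun u v => tlift (fun a b =>
      (lam b : k) *: (coord E i a *: u)) (D v)) (D L)).
    apply: eq_tlift => u v; rewrite (tlift_app (f := fun z => coord E i z *: u));
      last by lin.
    by apply: eq_tlift => a b; rewrite linearZ scalerA.
  rewrite -ha_coassoc; last by lin.
  transitivity (tlift (fun w b => (lam b : k) *:
    tlift (fun u a => coord E i a *: u) (D w)) (D L)).
    apply: eq_tlift => w b; rewrite (tlift_app (f := fun z => (lam b : k) *: z)) //;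
      lin.
  transitivity (tlift (fun u a => coord E i a *: u)
    (D (tlift (fun w b => (lam b : k) *: w) (D L)))).
    rewrite (tlift_app (f := fun z => tlift (fun u a => coord E i a *: u) (D z)));
      last by lin.
    by apply: eq_tlift => w b; rewrite !linearZ.
  by rewrite lamL ha_comul1 tlift_pure //; lin.
rewrite -[X in _ *: X]lamL (tlift_app (f := fun z => (coord E i 1_A : k) *: z));
  last by lin.
by apply: eq_tlift => u v; rewrite scalerA mulrC.
Qed.

Lemma cointegral_integral : lam L = 1.
Proof.
have /eqP := cointegralP L; rewrite lamL -subr_eq0 -{1}[1_A]scale1r -scalerBl.
by rewrite scaler_eq0 (negPf alg1_neq0) orbF subr_eq0 => /eqP.
Qed.

(** Both sides have image mu(L) 1 under the injective map f |-> L_1 f(L_2). *)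
Lemma cointegral_uniq (mu : A -> k^o) : linear mu ->
  (forall x, tlift (fun u v => (mu v : k) *: u) (D x) = (mu x : k) *: 1_A) ->
  forall x, mu x = (mu L : k) *: lam x.
Proof.
move=> mul muP; apply: (integral_nondeg2 (f' := fun x => (mu L : k) *: lam x)) => //.
  by lin.
rewrite muP -lamL (tlift_app (f := fun z => (mu L : k) *: z)); last by lin.
by apply: eq_tlift => u v; rewrite scalerA.
Qed.

(** The distinguished grouplike element of A: by [cointegral_comul], it measures how far the
    one-sided cointegral [lam] is from being two-sided. *)
Definition dist_grouplike := tlift (fun u v => (lam u : k) *: v) (D L).
Local Notation g := dist_grouplike.

(** Each coordinate of x |-> lam(x_1) x_2 again satisfies the identity of [cointegralP], hence is a
    multiple of [lam]; its value at L, a coordinate of g, is the factor. *)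
Lemma cointegral_comul x : tlift (fun u v => (lam u : k) *: v) (D x) = (lam x : k) *: g.
Proof.
rewrite -[LHS]sum_coord_vbasis -[RHS]sum_coord_vbasis; apply: eq_bigr => i _.
congr (_ *: _); rewrite [RHS]linearZ /=.
rewrite [LHS](cointegral_uniq
  (mu := fun x => coord E i (tlift (fun u v => (lam u : k) *: v) (D x)))); last 1 first.
- move=> {}x.
  transitivity (tlift (fun a b => tlift (fun u v =>
     (lam u : k) *: (coord E i v *: a)) (D b)) (D x)).
    apply: eq_tlift => a b; rewrite (tlift_app (f := fun z => coord E i z *: a));
      last by lin.
    by apply: eq_tlift => u v; rewrite linearZ scalerA.
  rewrite -ha_coassoc; last by lin.
  transitivity (tlift (fun w v => coord E i v *: ((lam w : k) *: 1_A)) (D x)).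
    apply: eq_tlift => w v; rewrite -cointegralP.
    rewrite (tlift_app (f := fun z => coord E i v *: z)); last by lin.
    by apply: eq_tlift => a u; rewrite scalerA mulrC -scalerA.
  rewrite (tlift_app (f := fun z => coord E i z *: 1_A)); last by lin.
  by apply: eq_tlift => w v; rewrite scalerA linearZ mulrC.
- exact: mulrC.
by lin.
Qed.

Lemma dist_grouplikeP : D g = tpure g g.
Proof.
suff gb X (b : A -> A -> X) : bilinear_map b -> tlift b (D g) = b g g.
  by rewrite -[LHS]tlift_tpure gb //; apply: tpure_bilinear.
move=> bb; rewrite {1}/dist_grouplike (tlift_app (f := fun z => tlift b (D z)));
  last by lin.
transitivity (tlift (fun u v => tlift (fun a b' => (lam u : k) *: b a b') (D v)) (D L)).
  apply: eq_tlift => u v; rewrite !linearZ /=.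
  by rewrite (tlift_app (f := fun z : X => (lam u : k) *: z)) //; lin.
rewrite -ha_coassoc; last by lin.
transitivity (tlift (fun w v => b ((lam w : k) *: g) v) (D L)).
  apply: eq_tlift => w v; rewrite -cointegral_comul.
  rewrite (tlift_app (f := fun z => b z v)); last by lin.
  by apply: eq_tlift => u a; rewrite (linear_scale _ _ (f := fun z => b z v)) //; lin.
rewrite [X in _ = b _ X]/dist_grouplike (tlift_app (f := fun z => b g z)); last by lin.
apply: eq_tlift => w v.
rewrite (linear_scale _ _ (f := fun z => b z v)); last by lin.
by rewrite (linear_scale _ _ (f := fun z => b g z)) //; lin.
Qed.

Lemma counit_dist_grouplike : eps g = 1.
Proof.
rewrite /dist_grouplike (tlift_app (f := eps)); last by lin.
rewrite -cointegral_integral -[RHS](counitr_app (f := lam)) //.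
by apply: eq_tlift => u v; rewrite linearZ [LHS]mulrC.
Qed.

Lemma integral_mulr h : left_integral (L ** h).
Proof. by move=> x; rewrite hmulA Li hmulZl. Qed.

(** L h is a left integral, hence a multiple of L; since lam(L) = 1, applying [lam] reads off the
    factor. *)
Definition modular h : k^o := lam (L ** h).
Local Notation nu := modular.

Lemma linear_modular : linear nu.
Proof. by rewrite /modular; lin. Qed.

Lemma modularP h : L ** h = (nu h : k) *: L.
Proof.
have [c Lh] := integral_uniq (integral_mulr h).
rewrite /modular Lh (linear_scale _ _ laml) cointegral_integral.
by rewrite -[c *: 1]/(c * 1) mulr1.
Qed.

Lemma modular1 : nu 1_A = 1.
Proof. by rewrite /modular hmul1r cointegral_integral. Qed.

Lemma modularM x y : nu (x ** y) = (nu x : k) * (nu y : k).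
Proof. by rewrite {1}/modular hmulA modularP hmulZl (linear_scale _ _ laml). Qed.

Variable Si : {linear A -> A}.
Hypotheses (SK : cancel S Si) (SiK : cancel Si S).

Lemma antipode_invM x y : Si (x ** y) = Si y ** Si x.
Proof. by apply: antipode_inj; rewrite antipodeM !SiK. Qed.

Lemma antipode_inv1 : Si 1_A = 1_A.
Proof. by rewrite -[in LHS]antipode1 SK. Qed.

Lemma antipode_invl_app X (f : A -> X) x : linear f ->
  tlift (fun u v => f (Si v ** u)) (D x) = (eps x : k) *: f 1_A.
Proof.
move=> fl; transitivity (tlift (fun u v => f (Si (S u ** v))) (D x)).
  by apply: eq_tlift => u v; rewrite antipode_invM SK.
by rewrite (antipodel_app (f := fun z => f (Si z))) ?antipode_inv1 //; lin.
Qed.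

Lemma antipode_invr_app X (f : A -> X) x : linear f ->
  tlift (fun u v => f (v ** Si u)) (D x) = (eps x : k) *: f 1_A.
Proof.
move=> fl; transitivity (tlift (fun u v => f (Si (u ** S v))) (D x)).
  by apply: eq_tlift => u v; rewrite antipode_invM SK.
by rewrite (antipoder_app (f := fun z => f (Si z))) ?antipode_inv1 //; lin.
Qed.

Lemma cointegral_antipode h : tlift (fun u v => (lam (h ** v) : k) *: u) (D L) = S h.
Proof. by rewrite tlift_integral_mul // lamL hmul1r. Qed.

(** Inserting h_2 S^-1(h_1) to the right of L_1 completes L_2 h_3 to the coproduct of a product L
    h', to which [cointegralP] applies with lam(L h') = nu(h'). *)
Lemma integral_mul_cointegral_r h :
  tlift (fun u v => (lam (v ** h) : k) *: u) (D L) =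
  tlift (fun p q => (nu q : k) *: Si p) (D h).
Proof.
transitivity (tlift (fun p q => tlift (fun a b => tlift (fun u v =>
    (lam (v ** b) : k) *: (u ** a ** Si p)) (D L)) (D q)) (D h)).
  rewrite -ha_coassoc; last by lin.
  rewrite -(counitl_app
    (f := fun h => tlift (fun u v => (lam (v ** h) : k) *: u) (D L))); last by lin.
  apply: eq_tlift => p q.
  rewrite tlift_exch (tlift_app (f := fun z => (eps p : k) *: z)); last by lin.
  apply: eq_tlift => u v.
  rewrite -[in LHS](hmul1r u)
    -(antipode_invr_app (f := fun z => (lam (v ** q) : k) *: (u ** z))); last by lin.
  by apply: eq_tlift => a b; rewrite hmulA.
apply: eq_tlift => p q.
transitivity (tlift (fun u v => (lam v : k) *: (u ** Si p)) (D (L ** q))).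
  by rewrite (sweedlerM (b := fun u v => (lam v : k) *: (u ** Si p))) 1?tlift_exch //;
    lin.
transitivity (tlift (fun u v => (lam v : k) *: u) (D (L ** q)) ** Si p).
  rewrite (tlift_app (f := fun z => z ** Si p)); last by lin.
  by apply: eq_tlift => u v; rewrite hmulZl.
by rewrite cointegralP hmulZl hmul1l.
Qed.

Lemma integral_mul_cointegral_l h :
  tlift (fun u v => (lam (u ** h) : k) *: v) (D L) =
  tlift (fun p q => (nu p : k) *: (g ** S q)) (D h).
Proof.
transitivity (tlift (fun p q => tlift (fun a b => tlift (fun u v =>
    (lam (u ** a) : k) *: (v ** b ** S q)) (D L)) (D p)) (D h)).
  rewrite ha_coassoc; last by lin.
  rewrite -(counitr_app
    (f := fun h => tlift (fun u v => (lam (u ** h) : k) *: v) (D L))); last by lin.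
  apply: eq_tlift => p q.
  rewrite tlift_exch (tlift_app (f := fun z => (eps q : k) *: z)); last by lin.
  apply: eq_tlift => u v.
  rewrite -[in LHS](hmul1r v)
    -(antipoder_app (f := fun z => (lam (u ** p) : k) *: (v ** z))); last by lin.
  by apply: eq_tlift => a b; rewrite hmulA.
apply: eq_tlift => p q.
transitivity (tlift (fun u v => (lam u : k) *: (v ** S q)) (D (L ** p))).
  by rewrite (sweedlerM (b := fun u v => (lam u : k) *: (v ** S q))) 1?tlift_exch //;
    lin.
transitivity (tlift (fun u v => (lam u : k) *: v) (D (L ** p)) ** S q).
  rewrite (tlift_app (f := fun z => z ** S q)); last by lin.
  by apply: eq_tlift => u v; rewrite hmulZl.
by rewrite cointegral_comul hmulZl.
Qed.

(** Inserting S^-1(h_3) h_2 to the left of L_2 produces Delta(h' L), which collapses to eps(h')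
    Delta(L); then [cointegral_comul] at L gives g. *)
Lemma cointegral_antipode_inv h :
  tlift (fun u v => (lam (h ** u) : k) *: v) (D L) = Si h ** g.
Proof.
transitivity (tlift (fun p q => tlift (fun a b => tlift (fun u v =>
    (lam (a ** u) : k) *: (Si q ** b ** v)) (D L)) (D p)) (D h)).
  rewrite ha_coassoc; last by lin.
  rewrite -(counitr_app
    (f := fun h => tlift (fun u v => (lam (h ** u) : k) *: v) (D L))); last by lin.
  apply: eq_tlift => p q.
  rewrite tlift_exch (tlift_app (f := fun z => (eps q : k) *: z)); last by lin.
  apply: eq_tlift => u v.
  by rewrite (antipode_invl_app (f := fun z => (lam (p ** u) : k) *: (z ** v)))
    ?hmul1l //; lin.
rewrite -(counitl_app (f := fun h => Si h ** g)); last by lin.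
apply: eq_tlift => p q.
transitivity (tlift (fun u v => (lam u : k) *: (Si q ** v)) (D (p ** L))).
  rewrite (sweedlerM (b := fun u v => (lam u : k) *: (Si q ** v))); last by lin.
  by apply: eq_tlift => a b; apply: eq_tlift => u v; rewrite hmulA.
transitivity (Si q ** tlift (fun u v => (lam u : k) *: v) (D (p ** L))).
  rewrite (tlift_app (f := fun z => Si q ** z)); last by lin.
  by apply: eq_tlift => u v; rewrite hmulZr.
rewrite cointegral_comul Li (linear_scale _ _ laml) cointegral_integral hmulZr.
by rewrite -[_ *: 1]/(_ * 1) mulr1.
Qed.

End Cointegral.

End Integral.

Definition grouplike (g : A) : Prop := D g = tpure g g /\ eps g = 1.
Definition character (nu : A -> k^o) : Prop :=
  [/\ linear nu, nu 1_A = 1 & forall x y, nu (x ** y) = (nu x : k) * (nu y : k)].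

Definition translr (f : A -> k^o) h := tlift (fun u v => (f v : k) *: u) (D h).
Definition transll (f : A -> k^o) h := tlift (fun u v => (f u : k) *: v) (D h).

Lemma grouplike_antipodel g : grouplike g -> S g ** g = 1_A.
Proof.
case=> Dg eg; have := ha_antipodel g; rewrite Dg tlift_pure; last by lin.
by rewrite eg scale1r.
Qed.

Lemma grouplike_antipoder g : grouplike g -> g ** S g = 1_A.
Proof.
case=> Dg eg; have := ha_antipoder g; rewrite Dg tlift_pure; last by lin.
by rewrite eg scale1r.
Qed.

Lemma grouplike_antipode2 g : grouplike g -> S (S g) = g.
Proof.
move=> gg; have e := grouplike_antipoder gg.
have: S (g ** S g) ** g = g by rewrite e antipode1 hmul1l.
by rewrite antipodeM -hmulA (grouplike_antipodel gg) hmul1r.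
Qed.

Theorem radford_antipode4 : exists g nu, [/\ grouplike g, character nu &
  forall h, translr nu h = g ** S (S (S (S (transll nu h)))) ** S g].
Proof.
have [L Li L0] := exists_integral.
have [lam laml lamL] := integral_surj Li L0 1_A.
have [Si [SK SiK]] := antipode_bij Li L0.
set g := dist_grouplike L lam; set nu := modular L lam.
have nul : linear nu by apply: linear_modular.
have gg : grouplike g by split; [apply: dist_grouplikeP | apply: counit_dist_grouplike].
exists g, nu; split=> // [|h].
  by split=> //; [apply: modular1 | apply: modularM].
(* N is the image of h under the Nakayama automorphism of lam; comparing its
   expressions through the two legs of L gives the formula. *)
pose N := Si (tlift (fun u v => (lam (v ** h) : k) *: u) (D L)).
have NP y : lam (N ** y) = lam (y ** h).
  apply: (integral_nondeg2 Li L0 (f := fun y => lam (N ** y))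
    (f' := fun y => lam (y ** h))); [lin|lin|].
  by rewrite (cointegral_antipode Li) // SiK.
have SN : S N = Si (translr nu h).
  rewrite SiK (integral_mul_cointegral_r Li L0 laml lamL SK SiK) /translr.
  by rewrite (tlift_app (f := Si)); [apply: eq_tlift => u v; rewrite linearZ | lin].
have SiN : Si N ** g = g ** S (transll nu h).
  rewrite -(cointegral_antipode_inv Li L0 laml lamL SK SiK).
  transitivity (tlift (fun u v => (lam (u ** h) : k) *: v) (D L)).
    by apply: eq_tlift => u v; rewrite NP.
  rewrite (integral_mul_cointegral_l Li L0 laml lamL) /transll.
  rewrite (tlift_app (f := fun z => g ** S z)); last by lin.
  by apply: eq_tlift => u v; rewrite linearZ hmulZr.
have Sconj x : S (g ** x ** S g) = g ** S x ** S g.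
  by rewrite !antipodeM (grouplike_antipode2 gg) hmulA.
(* S(N) = S^-1(h_1 nu(h_2)) and S^-1(N) = g S(nu(h_1) h_2) g^-1. Applying S to the first and S^3 to
   the second gives two expressions of S^2(N). *)
rewrite -[LHS]SiK -SN -[in LHS](SiK N).
have -> : Si N = g ** S (transll nu h) ** S g.
  by rewrite -SiN -hmulA (grouplike_antipoder gg) hmul1r.
by rewrite !Sconj.
Qed.

End HopfTheory.

Section IterCommute.

Variables (T : Type) (f g : T -> T).
Hypothesis fg : forall x, f (g x) = g (f x).

Lemma iter_commute n x : iter n f (g x) = g (iter n f x).
Proof. by elim: n => //= n ->. Qed.

Lemma iter_comp_commute n x : iter n (fun y => f (g y)) x = iter n f (iter n g x).
Proof. by elim: n => //= n ->; rewrite iter_commute. Qed.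

End IterCommute.

Section AntipodeOrder.

Variables (k : fieldType) (A : hopfAlgebra k).
Implicit Types (x y z h u v g : A) (nu f : A -> k^o).

Local Notation "x ** y" := (alg_mul (ha_alg A) x y) (at level 40, left associativity).
Local Notation "1_A" := (alg_one (ha_alg A)).
Local Notation S := (ha_antipode A).
Local Notation eps := (ha_counit A).
Local Notation D := (ha_comul A).

Lemma character_unit nu g : character nu -> grouplike g -> nu g != 0.
Proof.
move=> [_ nu1 nuM] gg; apply/eqP => ng0.
have := nuM g (S g); rewrite (grouplike_antipoder gg) nu1 ng0 mul0r => /eqP.
by rewrite (negPf (oner_neq0 _)).
Qed.

(** x |-> f([transll nu x]) is the convolution product of nu and f, so both sides are h_1 nu(h_2)
    f(h_3). *)
Lemma translr_comp nu f h : linear nu -> linear f ->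
  translr nu (translr f h) = translr (fun x => f (transll nu x)) h.
Proof.
move=> nul fl; rewrite /translr
  (tlift_app (f := fun z => tlift (fun u v => (nu v : k) *: u) (D z))); last by lin.
transitivity (tlift (fun u w =>
  tlift (fun a b => (nu b : k) *: ((f w : k) *: a)) (D u)) (D h)).
  apply: eq_tlift => u w; rewrite !linearZ /=
    (tlift_app (f := fun z => (f w : k) *: z)); last by lin.
  by apply: eq_tlift => a b; rewrite !scalerA mulrC.
rewrite ha_coassoc; last by lin.
apply: eq_tlift => u v; rewrite /transll (tlift_app (f := f)) //.
rewrite (tlift_app (f := fun z : k^o => (z : k) *: u)); last by move=> c x y;
  rewrite scalerDl scalerA.
by apply: eq_tlift => a b; rewrite (linear_scale _ _ fl) scalerA.
Qed.

Lemma translr_transll nu f h : linear nu -> linear f ->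
  translr nu (transll f h) = transll f (translr nu h).
Proof.
move=> nul fl; rewrite /translr /transll.
rewrite (tlift_app (f := fun z => tlift (fun u v => (nu v : k) *: u) (D z)));
  last by lin.
rewrite (tlift_app (f := fun z => tlift (fun u v => (f u : k) *: v) (D z)));
  last by lin.
transitivity (tlift (fun u w =>
  tlift (fun a b => (f u : k) *: ((nu b : k) *: a)) (D w)) (D h)).
  apply: eq_tlift => u w; rewrite !linearZ /=
    (tlift_app (f := fun z => (f u : k) *: z)) //; lin.
rewrite -ha_coassoc; last by lin.
apply: eq_tlift => u v; rewrite !linearZ /=
  (tlift_app (f := fun z => (nu v : k) *: z)); last by lin.
by apply: eq_tlift => a b; rewrite !scalerA mulrC.
Qed.

Lemma linear_transll f : linear f -> linear (@transll k A f).
Proof. by move=> fl; rewrite /transll; lin. Qed.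

Lemma linear_translr f : linear f -> linear (@translr k A f).
Proof. by move=> fl; rewrite /translr; lin. Qed.

Lemma linear_iter n (f : A -> A) : linear f -> linear (iter n f).
Proof. by move=> fl; elim: n => [|n IHn] c x y //=; rewrite IHn fl. Qed.

(** eps after n left translations is the n-th convolution power of nu. This transfers the period of
    the left translation to the right one. *)
Lemma translr_iter nu n h : linear nu ->
  iter n (translr nu) h = translr (fun x => eps (iter n (transll nu) x)) h.
Proof.
move=> nul; elim: n h => [|n IHn] h.
  by rewrite /translr /= ha_counitr.
have nutl : linear (iter n (transll nu : A -> A)).
  exact/linear_iter/linear_transll.
rewrite iterS IHn translr_comp //; last by lin.
by apply: eq_tlift => u v; rewrite -iterSr.
Qed.

Lemma translr_mulg nu g x : character nu -> grouplike g ->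
  translr nu (g ** x) = (nu g : k) *: (g ** translr nu x).
Proof.
move=> [nul nu1 nuM] [Dg eg]; rewrite /translr sweedlerM; last by lin.
rewrite Dg tlift_pure; last by lin.
rewrite (tlift_app (f := fun z => (nu g : k) *: (g ** z))); last by lin.
by apply: eq_tlift => u v; rewrite nuM hmulZr scalerA.
Qed.

Lemma translr_mulgr nu g x : character nu -> grouplike g ->
  translr nu (x ** g) = (nu g : k) *: (translr nu x ** g).
Proof.
move=> [nul nu1 nuM] [Dg eg]; rewrite /translr sweedlerM; last by lin.
rewrite Dg (tlift_app (f := fun z => (nu g : k) *: (z ** g))); last by lin.
apply: eq_tlift => u v; rewrite tlift_pure; last by lin.
by rewrite nuM hmulZl scalerA mulrC.
Qed.

Lemma transll_mulg nu g x : character nu -> grouplike g ->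
  transll nu (g ** x) = (nu g : k) *: (g ** transll nu x).
Proof.
move=> [nul nu1 nuM] [Dg eg]; rewrite /transll sweedlerM; last by lin.
rewrite Dg tlift_pure; last by lin.
rewrite (tlift_app (f := fun z => (nu g : k) *: (g ** z))); last by lin.
by apply: eq_tlift => u v; rewrite nuM hmulZr scalerA.
Qed.

Lemma transll_mulgr nu g x : character nu -> grouplike g ->
  transll nu (x ** g) = (nu g : k) *: (transll nu x ** g).
Proof.
move=> [nul nu1 nuM] [Dg eg]; rewrite /transll sweedlerM; last by lin.
rewrite Dg (tlift_app (f := fun z => (nu g : k) *: (z ** g))); last by lin.
apply: eq_tlift => u v; rewrite tlift_pure; last by lin.
by rewrite nuM hmulZl scalerA mulrC.
Qed.

(** Translation by nu commutes with multiplication by g only up to the scalar c = nu(g); in a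
    conjugation, c and its inverse cancel. *)
Lemma commute_conj (R : A -> A) (c : k) g : grouplike g -> c != 0 -> linear R ->
  (forall x, R (g ** x) = c *: (g ** R x)) ->
  (forall x, R (x ** g) = c *: (R x ** g)) ->
  forall x, R (S g ** x ** g) = S g ** R x ** g.
Proof.
move=> gg c0 Rl Rgl Rgr x.
rewrite -[LHS]hmul1l -(grouplike_antipodel gg) -hmulA.
apply: (can_inj (scalerK c0)); rewrite -hmulZr -Rgl !hmulA.
by rewrite (grouplike_antipoder gg) hmul1l Rgr hmulZr -hmulA.
Qed.

(** Solving Radford's formula for S^4 gives C R P, with C conjugation by g^-1, R the right
    translation and P the inverse of the left one. They commute, so n-th powers are taken factor by
    factor. *)
Lemma antipode4_order n : (0 < n)%N ->
  (forall g, grouplike g -> iter n (alg_mul (ha_alg A) g) 1_A = 1_A) ->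
  (forall nu, character nu -> forall h, iter n (transll nu) h = h) ->
  forall h, iter n (fun x => S (S (S (S x)))) h = h.
Proof.
move=> n0 gn nun; have [g [nu [gg nuc Rad]]] := radford_antipode4 A.
have [nul nu1 nuM] := nuc.
have ng0 := character_unit nuc gg.
pose C x := S g ** x ** g; pose R := translr nu; pose T := transll nu.
pose P x := iter n.-1 T x.
have TP h : T (P h) = h by rewrite /P -iterS prednK //; apply: nun.
have XE h : S (S (S (S h))) = C (R (P h)).
  rewrite /C /R Rad -/T TP !hmulA (grouplike_antipodel gg) hmul1l -hmulA.
  by rewrite (grouplike_antipodel gg) hmul1r.
have Rl : linear R by apply: linear_translr.
have Tl : linear T by apply: linear_transll.
have CR x : C (R x) = R (C x).
  symmetry; apply: (commute_conj gg ng0) => // y;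
    [exact: translr_mulg | exact: translr_mulgr].
have CT x : C (T x) = T (C x).
  symmetry; apply: (commute_conj gg ng0) => // y;
    [exact: transll_mulg | exact: transll_mulgr].
have RT x : R (T x) = T (R x) by apply: translr_transll.
have RP x : R (P x) = P (R x).
  by rewrite /P -(iter_commute (f := T) (g := R)).
have CP x : C (P x) = P (C x).
  by rewrite /P -(iter_commute (f := T) (g := C)).
move=> h; transitivity (iter n (fun x => C (R (P x))) h).
  by apply: eq_iter.
rewrite (iter_comp_commute (f := C) (g := fun x => R (P x))); last first.
  by move=> x; rewrite CR CP.
rewrite (iter_comp_commute (f := R) (g := P)) //.
have iterP x : iter n P x = x.
  suff: iter n T (iter n P x) = x by rewrite nun.
  by rewrite -(iter_comp_commute (f := T) (g := P)) ?(eq_iter TP) ?iter_fix // => y;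
    rewrite /P iter_commute.
have iterR x : iter n R x = x.
  rewrite /R translr_iter //; rewrite /translr -[RHS]ha_counitr.
  by apply: eq_tlift => u v; rewrite nun.
have gnl x : iter n (alg_mul (ha_alg A) g) x = x.
  suff -> : iter n (alg_mul (ha_alg A) g) x = iter n (alg_mul (ha_alg A) g) 1_A ** x
    by rewrite gn // hmul1l.
  by elim: (n) => [|m IHm] /=; rewrite ?hmul1l // IHm hmulA.
have gnr x : iter n (fun y => y ** g) x = x.
  suff -> : iter n (fun y => y ** g) x = x ** iter n (alg_mul (ha_alg A) g) 1_A by
    rewrite gn // hmul1r.
  elim: (n) => [|m IHm] /=; rewrite ?hmul1r // IHm -hmulA; congr (x ** _).
  by elim: (m) => [|p IHp] /=; rewrite ?hmul1l ?hmul1r // -hmulA IHp.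
have Sgn x : iter n (fun y => S g ** y) x = x.
  rewrite -[LHS]gnl -(iter_comp_commute (f := alg_mul (ha_alg A) g)
    (g := fun y => S g ** y)).
    rewrite (eq_iter (f' := id)) ?iter_fix // => y.
    by rewrite hmulA (grouplike_antipoder gg) hmul1l.
  by move=> y; rewrite !hmulA (grouplike_antipoder gg) (grouplike_antipodel gg).
rewrite iterP iterR /C
  (iter_comp_commute (f := fun y => y ** g) (g := fun y => S g ** y)).
  by rewrite gnr Sgn.
by move=> x; rewrite hmulA.
Qed.

End AntipodeOrder.

(** * Matrices R such that R (x) R is similar to R (x) id *)

Section SplittingField.

(** Descent on the degree, deciding irreducibility by excluded middle. Working under [classically]
    is enough because the divisibility proved in the end is a boolean. *)
Lemma classically_irreducible_factor (F : fieldType) (p : {poly F}) :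
  (1 < size p)%N -> classically (exists2 q, irreducible_poly q & q %| p).
Proof.
have [n] := ubnP (size p); elim: n p => // n IHn p /ltnSE-le_pn p_gt1.
move=> b Hb; refine (@classic_EM (irreducible_poly p) b _) => -[irrp | nirrp].
  by apply: Hb; exists p.
refine (@classic_EM (exists q : {poly F},
  [/\ size q != 1%N, q %| p & ~~ (q %= p)]) b _); case=> [[q [q1 qp nqp]] | nq];
    last first.
  case: nirrp; split=> // q q1 qp; apply/negPn/negP => nqp.
  by apply: nq; exists q.
have p0 : p != 0 by rewrite -size_poly_gt0 ltnW.
have q0 : q != 0 by apply: contraTneq qp => ->; rewrite dvd0p.
have q_gt1 : (1 < size q)%N by rewrite ltn_neqAle eq_sym q1 size_poly_gt0.
apply: (IHn q) => //.
  apply: leq_trans le_pn; rewrite ltn_neqAle dvdp_leq // andbT.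
  by rewrite dvdp_size_eqp.
by case=> r irrr rq; apply: Hb; exists r => //; apply: dvdp_trans qp.
Qed.

(** Adjoin a root of an irreducible factor, then split the cofactor over the extension; the
    induction therefore quantifies over the field. *)
Lemma classically_splitting_field (F : fieldType) (p : {poly F}) : p != 0 ->
  classically (exists (E : fieldType) (f : {rmorphism F -> E}) (rs : seq E),
    map_poly f p %= \prod_(x <- rs) ('X - x%:P)).
Proof.
have [n] := ubnP (size p); elim: n F p => // n IHn F p /ltnSE-le_pn p0.
have [p_le1 | p_gt1] := leqP (size p) 1.
  move=> b Hb; apply: Hb; exists F, idfun, [::]; rewrite big_nil map_poly_id //.
  by rewrite -size_poly_eq1 eqn_leq p_le1 size_poly_gt0.
move=> b Hb; refine (classically_irreducible_factor p_gt1 _) => -[q irrq qp].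
have [L _ [z qz0 _]] := irredp_FAdjoin irrq.
have pz0 : root (map_poly (in_alg L) p) z.
  by move: qz0; rewrite !root_factor_theorem => /dvdp_trans-> //; rewrite dvdp_map.
have /factor_theorem[p' Dp] := pz0.
have mp0 : map_poly (in_alg L) p != 0 by rewrite map_poly_eq0.
have p'0 : p' != 0 by apply: contraNneq mp0 => p'0; rewrite Dp p'0 mul0r.
have sp' : (size p' < n)%N.
  have := size_map_poly (in_alg L) p; rewrite Dp size_Mmonic ?monicXsubC //.
  by rewrite size_XsubC addn2 /= => sp; rewrite -sp in le_pn.
refine (IHn L p' sp' p'0 b _) => -[E [f [rs frs]]].
apply: Hb; exists E, (f \o in_alg L), (f z :: rs).
rewrite map_poly_comp /= Dp rmorphM /= map_polyXsubC big_cons mulrC.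
by rewrite eqp_mul2l ?polyXsubC_eq0.
Qed.

End SplittingField.

Section EquidistributedRoots.

Variables (E : fieldType) (n : nat) (d : 'I_n -> E) (m : nat) (rs : seq E).
Hypotheses (rsU : uniq rs) (rs_size : size rs = m)
  (rsP : forall z, (z \in rs) = (z ^+ m == 1)).
Hypotheses (d_rs : forall i, d i \in rs)
  (rs_d : forall z, z \in rs -> exists i, d i = z).

Let f c : nat := \sum_i (d i == c).

Hypothesis dd : forall c, (\sum_i \sum_j ((d i * d j)%R == c) = n * f c)%N.

(* The convolution square of f is n f; comparing at a maximum of f forces f to
   be constant on the group of m-th roots of unity. *)
Lemma dvdn_equidistributed : (m %| n)%N.
Proof.
have [n0 | n_gt0] := posnP n; first by rewrite n0 dvdn0.
have unit_rs z : z \in rs -> z != 0.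
  move=> zr; apply: contraTneq zr => ->; rewrite rsP expr0n.
  have : d (Ordinal n_gt0) \in rs by [].
  rewrite -rs_size; case: (rs) => //= z0 r _.
  by rewrite eq_sym oner_eq0.
have rs_div y z : y \in rs -> z \in rs -> y / z \in rs.
  by rewrite !rsP expr_div_n => /eqP-> /eqP->; rewrite divr1.
have conv c : (n * f c)%N = \sum_j f (c / d j).
  rewrite -dd exchange_big; apply: eq_bigr => j _; apply: eq_bigr => i _.
  by rewrite (can2_eq (mulfK (unit_rs _ (d_rs j))) (divfK (unit_rs _ (d_rs j)))).
case: (arg_maxnP (P := xpredT) (fun i => f (d i)) (i0 := Ordinal n_gt0)) =>
  // i0 _ fmax.
set c0 := d i0 in fmax.
have fle z : z \in rs -> (f z <= f c0)%N by move=> /rs_d[i <-]; apply: fmax.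
have fc j : f (c0 / d j) = f c0.
  have : \sum_j (f c0 - f (c0 / d j)%R)%N == 0%N.
    rewrite sumnB => [|i _]; last by rewrite fle ?rs_div ?d_rs.
    by rewrite -conv sum_nat_const card_ord subnn.
  rewrite sum_nat_eq0 => /forallP/(_ j)/=; rewrite subn_eq0 => fj.
  by apply/eqP; rewrite eqn_leq fj fle ?rs_div ?d_rs.
have fz z : z \in rs -> f z = f c0.
  move=> zr; have [j dj] := rs_d (rs_div _ _ (d_rs i0) zr).
  by rewrite -(fc j) dj invf_div mulrCA divff ?mulr1 ?unit_rs ?d_rs.
suff -> : n = (m * f c0)%N by apply: dvdn_mulr.
transitivity (\sum_(z <- rs) f z)%N; last first.
  rewrite big_seq (eq_bigr (fun=> f c0)) => [|z /fz //].
  by rewrite -big_seq big_const_seq count_predT iter_addn_0 mulnC rs_size.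
rewrite exchange_big /= -[LHS]card_ord -sum1_card; apply: eq_bigr => i _.
rewrite (bigD1_seq (d i)) //= eqxx big1_seq // => z /andP[nz _].
by rewrite eq_sym (negPf nz).
Qed.

End EquidistributedRoots.

Section CharPolySimilar.

Lemma char_poly_similar (k : fieldType) n (P A B : 'M[k]_n) : P \in unitmx ->
  A *m P = P *m B -> char_poly A = char_poly B.
Proof.
move=> Pu AP; pose P' := map_mx polyC P.
have P'0 : \det P' != 0 by rewrite det_map_mx polyC_eq0 -unitfE -unitmxE.
apply: (mulIf P'0); rewrite mulrC [RHS]mulrC.
rewrite /char_poly [LHS]mulrC -!det_mulmx; congr (\det _).
rewrite /char_poly_mx mulmxBl mulmxBr -!map_mxM AP; congr (_ - _).
by rewrite scalar_mxC.
Qed.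

End CharPolySimilar.

(** * The matrices of R (x) R and R (x) id *)

Section TensorSquare.

Variable k : fieldType.

(** R (x) R on tensors given by coordinate matrices X, where it is X |-> R^T X R, flattened by
    [mxvec]. In the same model [ltsquare_mx] is R (x) id. *)
Definition tsquare_mx n (R : 'M[k]_n) : 'M[k]_(n * n) :=
  lin_mulmx R^T *m lin_mulmxr R.

Lemma tsquare_mxE n (R X : 'M[k]_n) :
  mxvec X *m tsquare_mx R = mxvec (R^T *m X *m R).
Proof. by rewrite /tsquare_mx mulmxA !mul_vec_lin. Qed.

Lemma eq_mul_mxvec n (A B : 'M[k]_(n * n, n * n)) :
  (forall X : 'M[k]_n, mxvec X *m A = mxvec X *m B) -> A = B.
Proof.
move=> AB; apply/row_matrixP => i.
by rewrite !rowE -[delta_mx 0 i]vec_mxK.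
Qed.

Lemma diag_tsquare n (d : 'rV[k]_n) :
  tsquare_mx (diag_mx d) = diag_mx (mxvec (\matrix_(i, j) (d 0 i * d 0 j))).
Proof.
apply: eq_mul_mxvec => X; rewrite tsquare_mxE tr_diag_mx.
apply/rowP => t; case/mxvec_indexP: t => i j.
by rewrite mul_mx_diag !mxE !mxvecE mul_mx_diag mul_diag_mx !mxE mulrAC mulrC mulrA.
Qed.

Lemma diag_lin_mulmx n (d : 'rV[k]_n) :
  lin_mulmx (diag_mx d) = diag_mx (mxvec (\matrix_(i, j < n) d 0 i)).
Proof.
apply: eq_mul_mxvec => X; rewrite mul_vec_lin /=.
apply/rowP => t; case/mxvec_indexP: t => i j.
by rewrite mul_mx_diag !mxE !mxvecE mul_diag_mx !mxE mulrC.
Qed.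

Definition ltsquare_mx n (R : 'M[k]_n) : 'M[k]_(n * n) := lin_mulmx R^T.

Lemma ltsquare_mxE n (R X : 'M[k]_n) : mxvec X *m ltsquare_mx R = mxvec (R^T *m X).
Proof. by rewrite mul_vec_lin. Qed.

Lemma tsquare_mxM n (R R' : 'M[k]_n) :
  tsquare_mx (R *m R') = tsquare_mx R *m tsquare_mx R'.
Proof.
by apply: eq_mul_mxvec => X; rewrite mulmxA !tsquare_mxE trmx_mul !mulmxA.
Qed.

Lemma ltsquare_mxM n (R R' : 'M[k]_n) :
  ltsquare_mx (R *m R') = ltsquare_mx R *m ltsquare_mx R'.
Proof.
by apply: eq_mul_mxvec => X; rewrite mulmxA !ltsquare_mxE trmx_mul !mulmxA.
Qed.

Lemma tsquare_mx1 n : tsquare_mx (1%:M : 'M[k]_n) = 1%:M.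
Proof. by apply: eq_mul_mxvec => X; rewrite tsquare_mxE trmx1 mul1mx !mulmx1. Qed.

Lemma ltsquare_mx1 n : ltsquare_mx (1%:M : 'M[k]_n) = 1%:M.
Proof. by apply: eq_mul_mxvec => X; rewrite ltsquare_mxE trmx1 mul1mx !mulmx1. Qed.

Lemma tsquare_mx_exp n (R : 'M[k]_n) F s : tsquare_mx R *m F = F *m ltsquare_mx R ->
  tsquare_mx (R ^+ s) *m F = F *m ltsquare_mx (R ^+ s).
Proof.
move=> RF; elim: s => [|s IHs].
  by rewrite expr0 tsquare_mx1 ltsquare_mx1 mulmx1 mul1mx.
by rewrite exprS tsquare_mxM ltsquare_mxM -mulmxA IHs mulmxA RF mulmxA.
Qed.

Lemma char_poly_diag n (d : 'rV[k]_n) :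
  char_poly (diag_mx d) = \prod_(x <- [seq d 0 i | i : 'I_n]) ('X - x%:P).
Proof.
rewrite char_poly_trig ?diag_mx_is_trig // big_image /=.
by apply: eq_bigr => i _; rewrite mxE eqxx.
Qed.

Lemma count_mem_image (I : finType) (d : I -> k) c :
  count_mem c [seq d i | i : I] = (\sum_i (d i == c))%N.
Proof. by rewrite -sum1_count big_map big_mkcond big_enum. Qed.

Lemma sum_mxvec n (X : 'M[k]_n) (P : pred k) :
  (\sum_t P (mxvec X ord0 t) = \sum_i \sum_j P (X i j))%N.
Proof.
rewrite pair_bigA (reindex _ (curry_mxvec_bij n n)) /=.
by apply: eq_bigr => -[i j] _; rewrite mxvecE.
Qed.

End TensorSquare.

Lemma map_tsquare_mx (k E : fieldType) (f : {rmorphism k -> E}) n (R : 'M[k]_n) :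
  map_mx f (tsquare_mx R) = tsquare_mx (map_mx f R).
Proof.
rewrite /tsquare_mx map_mxM map_trmx; congr (_ *m _); apply: map_lin_mx => X.
  exact: map_mxM.
exact: map_mxM.
Qed.

Lemma map_ltsquare_mx (k E : fieldType) (f : {rmorphism k -> E}) n (R : 'M[k]_n) :
  map_mx f (ltsquare_mx R) = ltsquare_mx (map_mx f R).
Proof. by rewrite /ltsquare_mx map_trmx; apply: map_lin_mx => X; apply: map_mxM. Qed.

(** As m is nonzero in k, R is diagonalizable over a splitting field, and its eigenvalues are all
    the m-th roots of unity. The multiplicity of c in the characteristic polynomials of R (x) R and
    R (x) id gives the hypothesis of [dvdn_equidistributed]. *)
Lemma dvdn_tsquare_separable (k : fieldType) n (R : 'M[k]_n.+1) F m :
  F \in unitmx -> tsquare_mx R *m F = F *m ltsquare_mx R ->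
  mxminpoly R = 'X^m - 1 -> m%:R != 0 :> k -> (m %| n.+1)%N.
Proof.
move=> Fu RF minR m_neq0.
have m_gt0 : (0 < m)%N by case: (m) m_neq0 => //; rewrite mulr0n eqxx.
have pm0 (K : fieldType) : ('X^m - 1 : {poly K}) != 0.
  by rewrite monic_neq0 ?monicXnsubC.
have chR := char_poly_similar Fu RF.
refine (classically_splitting_field (pm0 k) _) => -[E [f [rs frs]]].
have Xm1 : 'X^m - 1 = \prod_(x <- rs) ('X - x%:P).
  apply/eqP; rewrite -eqp_monic ?monic_prod_XsubC ?monicXnsubC //.
  by move: frs; rewrite rmorphB /= map_polyXn rmorph1.
have rsU : uniq rs.
  rewrite -separable_prod_XsubC -Xm1 separable_Xn_sub_1 //.
  by rewrite -(rmorph_nat f) fmorph_eq0.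
have rsS : size rs = m.
  by have := congr1 (fun p : {poly E} => size p) Xm1;
    rewrite size_prod_XsubC size_XnsubC // => -[].
have rsP z : (z \in rs) = (z ^+ m == 1).
  by rewrite -root_prod_XsubC -Xm1 rootE !hornerE subr_eq0.
pose Rf := map_mx f R.
have minRf : mxminpoly Rf = \prod_(x <- rs) ('X - x%:P).
  by rewrite mxminpoly_map minR rmorphB /= map_polyXn rmorph1.
have [P Pu /(diagonalizable_forLR Pu)[d DRf']] : diagonalizable Rf.
  by apply/diagonalizableP; exists rs; rewrite // minRf.
have DRf : Rf = invmx P *m diag_mx d *m P.
  by rewrite DRf' mxpoly.conjumx ?unitmx_inv // invmxK.
have chd : char_poly (tsquare_mx (diag_mx d)) = char_poly (ltsquare_mx (diag_mx d)).
  have := congr1 (map_poly f) chR;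
    rewrite !map_char_poly map_tsquare_mx map_ltsquare_mx.
  rewrite -/Rf (@char_poly_similar _ _ (tsquare_mx (invmx P)) (tsquare_mx Rf)
    (tsquare_mx (diag_mx d))).
  - rewrite (@char_poly_similar _ _ (ltsquare_mx (invmx P)) (ltsquare_mx Rf)
    (ltsquare_mx (diag_mx d))) //.
      have : ltsquare_mx P *m ltsquare_mx (invmx P) = 1%:M.
        by rewrite -ltsquare_mxM mulmxV // ltsquare_mx1.
      by case/mulmx1_unit.
    by rewrite DRf -!ltsquare_mxM mulmxK.
  - have : tsquare_mx P *m tsquare_mx (invmx P) = 1%:M.
      by rewrite -tsquare_mxM mulmxV // tsquare_mx1.
    by case/mulmx1_unit.
  by rewrite DRf -!tsquare_mxM mulmxK.
have d_rs z : (z \in rs) = (z \in [seq d 0 i | i <- enum 'I_n.+1]).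
  rewrite -root_prod_XsubC -minRf DRf'.
  by rewrite mxpoly.mxminpoly_uconj ?unitmx_inv // mxminpoly_diag root_prod_XsubC
    mem_undup.
apply: (@dvdn_equidistributed E n.+1 (d 0) m rs) => //.
- by move=> i; rewrite d_rs map_f ?mem_enum.
- by move=> z; rewrite d_rs => /mapP[i _ ->]; exists i.
move=> c; have := congr1 (fun p => mup c p) chd.
rewrite diag_tsquare /ltsquare_mx tr_diag_mx diag_lin_mulmx !char_poly_diag
  !mu_prod_XsubC !count_mem_image.
rewrite !(sum_mxvec _ (fun x => x == c)).
under eq_bigr => i _ do under eq_bigr => j _ do rewrite mxE.
move=> ->; rewrite exchange_big /=.
under eq_bigr => j _ do under eq_bigr => i _ do rewrite mxE.
by rewrite big_const_ord iter_addn_0 mulnC.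
Qed.

(** * The case X^m - 1 = (X - 1)^m *)

Section Unipotent.

Variables (k : fieldType) (n : nat) (R : 'M[k]_n.+1) (m : nat).
Hypothesis m_gt0 : (0 < m)%N.
Hypothesis XmE : 'X^m - 1 = ('X - 1) ^+ m :> {poly k}.
Hypothesis minR : mxminpoly R = 'X^m - 1.

(** [e] is (R - 1)^(m-1) and also the norm 1 + R + ... + R^(m-1). Its rank [r] counts the Jordan
    blocks of the maximal size m, which is the rank of a largest free summand over k[X]/(X^m -
    1). *)
Let nu : {poly k} := ('X - 1) ^+ m.-1.
Let e := horner_mx R nu.
Let r := \rank e.

Lemma norm_polyE : nu = \sum_(i < m) 'X^i.
Proof.
have X1 : ('X - 1 : {poly k}) != 0 by rewrite -(polyC1 k) polyXsubC_eq0.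
apply: (mulfI X1); rewrite -exprS prednK // -XmE subrX1.
by congr (_ * _); apply: eq_bigr => i _.
Qed.

Lemma norm_mxE : e = \sum_(i < m) R ^+ i.
Proof.
rewrite /e norm_polyE rmorph_sum; apply: eq_bigr => i _ /=.
by rewrite rmorphXn /= horner_mx_X.
Qed.

Lemma rank_norm_gt0 : (0 < r)%N.
Proof.
rewrite lt0n mxrank_eq0 -dvd_mxminpoly minR XmE.
have X1 : ('X - 1 : {poly k}) != 0 by rewrite -(polyC1 k) polyXsubC_eq0.
apply/negP => /dvdp_leq; rewrite /nu expf_neq0 // => /(_ isT).
by rewrite -(polyC1 k) !size_exp_XsubC prednK // ltnn.
Qed.

(* If the p_j, all divisible by (X-1)^t with quotients q_j, satisfy
   sum_j U_j p_j(R) = 0, multiplying by (R-1)^(m-1-t) gives sum_j q_j(1) U_j e = 0. *)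
Lemma norm_free_poly s (U : 'M[k]_(s, n.+1)) (p : 'I_s -> {poly k}) :
  row_free (U *m e) -> (forall j, size (p j) <= m)%N ->
  \sum_j row j U *m horner_mx R (p j) = 0 -> forall j, p j = 0.
Proof.
move=> Ue p_m p0.
have X1 : ('X - 1 : {poly k}) != 0 by rewrite -(polyC1 k) polyXsubC_eq0.
have dvdp t : (t <= m)%N -> forall j, ('X - 1) ^+ t %| p j.
  elim: t => [|t IHt] t_m j; first by rewrite expr0 dvd1p.
  pose q j := p j %/ ('X - 1) ^+ t.
  have pE i : p i = q i * ('X - 1) ^+ t by rewrite divpK // IHt // ltnW.
  suff q1 : root (q j) 1.
    by rewrite pE exprS dvdp_mul2r ?expf_neq0 // -(polyC1 k) -root_factor_theorem.
  have eq1 i : horner_mx R (p i * ('X - 1) ^+ (m.-1 - t)) = (q i).[1] *: e.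
    have -> : p i * ('X - 1) ^+ (m.-1 - t) = q i * nu.
      by rewrite pE -mulrA -exprD subnKC // -ltnS prednK.
    have /factor_theorem[q' Dq] : root (q i - (q i).[1]%:P) 1.
      by rewrite rootE !hornerE subrr.
    have -> : q i * nu = q' * ('X^m - 1) + (q i).[1] *: nu.
      rewrite -{1}[q i](subrK ((q i).[1])%:P) Dq mulrDl mul_polyC -mulrA polyC1.
      by rewrite -exprS prednK // XmE.
    by rewrite rmorphD rmorphM /= -minR mx_root_minpoly mulr0 add0r linearZ.
  have /rowP/(_ j) : \row_i (q i).[1] = 0 :> 'rV[k]_s; last by rewrite !mxE rootE => ->.
  apply: (row_free_inj Ue); rewrite mul0mx mulmx_sum_row.
  transitivity ((\sum_j row j U *m horner_mx R (p j)) *m horner_mx R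
    (('X - 1) ^+ (m.-1 - t))).
    rewrite mulmx_suml; apply: eq_bigr => i _; rewrite mxE row_mul scalemxAr -eq1.
    by rewrite rmorphM -mulmxE mulmxA.
  by rewrite p0 mul0mx.
move=> j; apply/eqP; apply: contraTT (dvdp m (leqnn _) j) => pj0.
apply: contraTN (p_m j) => /dvdp_leq-/(_ pj0).
by rewrite -(polyC1 k) size_exp_XsubC -ltnNge.
Qed.

(** Let V be the whole space and W a free part of rank r. A free module tensored with anything is
    free, so W (x) V and (V/W) (x) W contribute r dim V + r dim(V/W) to the rank of the norm [E2] of
    R (x) R. But [F] conjugates [E2] to e (x) id, of rank at most r dim V. Hence V = W, of dimension
    m r. *)
Lemma dvdn_tsquare_unipotent F : F \in unitmx ->
  tsquare_mx R *m F = F *m ltsquare_mx R -> (m %| n.+1)%N.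
Proof.
move=> Fu RF.
have /submxP[U UE] : (row_base e <= e)%MS by rewrite eq_row_base.
have Ue : row_free (U *m e) by rewrite -UE row_base_free.
(* The rows of [G] are the translates U R^i; they span the free part, and [norm_free_poly] shows
   their independence. *)
pose G : 'M[k]_(m * r, n.+1) := \matrix_(t, a)
  let p := enum_val (cast_ord (esym (mxvec_cast m r)) t) in (U *m R ^+ p.1) p.2 a.
have GE i j a : G (mxvec_index i j) a = (U *m R ^+ i) j a.
  by rewrite mxE cast_ordK enum_rankK.
have idx_inj i i' j j' :
  (mxvec_index i j == mxvec_index i' j' :> 'I_(m * r)) = (i == i') && (j == j').
  have /bij_inj/inj_eq inj := onT_bij (curry_mxvec_bij m r).
  exact: (inj (i, j) (i', j')).
have Gfree : row_free G.
  apply: inj_row_free => u uG.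
  pose p (j : 'I_r) : {poly k} := \sum_(i < m) u 0 (mxvec_index i j) *: 'X^i.
  have p0 : forall j, p j = 0.
    apply: (norm_free_poly Ue) => [j|].
      apply: leq_trans (size_sum _ _ _) _; apply/bigmax_leqP => i _.
      by apply: leq_trans (size_scale_leq _ _) _; rewrite size_polyXn.
    transitivity (u *m G) => //; apply/rowP => a; rewrite summxE mxE.
    transitivity (\sum_j \sum_i u 0 (mxvec_index i j) * G (mxvec_index i j) a);
      last first.
      rewrite exchange_big pair_bigA [RHS](reindex _ (curry_mxvec_bij m r)) /=.
      by apply: eq_bigr => -[].
    apply: eq_bigr => j _; rewrite /p linear_sum mulmx_sumr summxE;
      apply: eq_bigr => i _.
    rewrite linearZ -scalemxAr rmorphXn /= horner_mx_X mxE GE; congr (_ * _).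
    by rewrite -row_mul mxE.
  apply/rowP => t; case/mxvec_indexP: t => i j; rewrite mxE.
  have /(congr1 (fun q : {poly k} => q`_i)) := p0 j.
  rewrite coef0 /p coef_sum (bigD1 i) //= coefZ coefXn eqxx mulr1 big1 ?addr0 // =>
    i' ni.
  by rewrite coefZ coefXn eq_sym -val_eqE in ni *; rewrite (negPf ni) mulr0.
have /row_freeP[B GB] := Gfree.
pose i0 := Ordinal m_gt0.
(* [pr] reads off the coordinates on the translates with i = 0, so it kills U R^i for every other
   i. *)
pose pr : 'M[k]_(n.+1, r) := \matrix_(a, j) B a (mxvec_index i0 j).
have Upr i : U *m R ^+ (i : 'I_m) *m pr = (i == i0)%:R%:M.
  apply/matrixP => l j.
  have /matrixP/(_ (mxvec_index i l) (mxvec_index i0 j)) := GB.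
  rewrite mxE [X in _ = X -> _]mxE idx_inj => GBE; rewrite mxE [RHS]mxE.
  transitivity (((i == i0) && (l == j))%:R : k).
    by rewrite -GBE; apply: eq_bigr => a _; rewrite GE [pr a j]mxE.
  by case: (i == i0) => //=; rewrite mul0rn.
(* [C'] is the quotient map by the free part; the rows of [M'] below lift a basis of that
   quotient. *)
set C := cokermx G; set C' := col_base C.
have GC : G *m C' = 0.
  apply: (row_free_inj (row_base_free C)).
  by rewrite -mulmxA mulmx_base mulmx_coker mul0mx.
have UC i : U *m R ^+ (i : 'I_m) *m C' = 0.
  apply/matrixP => l b; have /matrixP/(_ (mxvec_index i l) b) := GC.
  rewrite mxE [X in _ = X -> _]mxE => GCE; rewrite mxE [RHS]mxE -[RHS]GCE.
  by apply: eq_bigr => a _; rewrite GE.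
have /row_fullP[M0 M0C] : row_full C' by apply: col_base_full.
pose M' := M0 - M0 *m B *m G.
have M'C : M' *m C' = 1%:M by rewrite mulmxBl M0C -!mulmxA GC !mulmx0 subr0.
(* [J] generates U (x) V and M' (x) U; the norm [E2] will be injective on it, which bounds its rank
   from below. *)
pose J : 'M[k]_(r * n.+1 + \rank C * r, n.+1 * n.+1) :=
  col_mx (lin_mulmx U^T) (lin_mulmx M'^T *m lin_mulmxr U).
pose E2 := \sum_(i < m) tsquare_mx (R ^+ i).
have JE : row_free (J *m E2).
  apply: inj_row_free => v; rewrite -[v]hsubmxK mulmxA mul_row_col.
  rewrite -[lsubmx v]vec_mxK -[rsubmx v]vec_mxK.
  set a := vec_mx (lsubmx v); set b := vec_mx (rsubmx v).
  rewrite mulmxA !mul_vec_lin /= -linearD /=.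
  set X := _ + _; rewrite mulmx_sumr => XE2.
  have Z0 : \sum_(i < m) (R ^+ i)^T *m X *m R ^+ i = 0.
    apply: (can_inj mxvecK); rewrite linear0 -XE2 linear_sum.
    by apply: eq_bigr => i _; rewrite tsquare_mxE.
  (* C' on the left kills the part of X coming from [a], and [pr] on the right isolates the term i =
     0, leaving [b]; once b = 0, [pr] on the left isolates [a]. *)
  have b0 : b = 0.
    transitivity (C'^T *m (\sum_(i < m) (R ^+ i)^T *m X *m R ^+ i) *m pr); last first.
      by rewrite Z0 mulmx0 mul0mx.
    rewrite mulmx_sumr mulmx_suml (bigD1 i0) //= [X in _ + X]big1 ?addr0 => [|i ni].
      rewrite expr0 trmx1 mul1mx mulmx1 /X mulmxDr mulmxDl.
      have := UC i0; rewrite expr0 mulmx1 => UC0.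
      rewrite !mulmxA -trmx_mul UC0 trmx0 !mul0mx add0r -trmx_mul M'C trmx1 mul1mx.
      by have := Upr i0; rewrite expr0 mulmx1 eqxx -mulmxA => ->; rewrite mulmx1.
    have CRU : C'^T *m (R ^+ i)^T *m U^T = 0.
      by rewrite -!trmx_mul mulmxA UC trmx0.
    rewrite /X !(mulmxDr, mulmxDl) !mulmxA CRU !mul0mx add0r.
    by rewrite -!mulmxA [U *m (_ *m _)]mulmxA Upr (negPf ni) raddf0 !mulmx0.
  have a0 : a = 0.
    transitivity (pr^T *m (\sum_(i < m) (R ^+ i)^T *m X *m R ^+ i)); last first.
      by rewrite Z0 mulmx0.
    rewrite /X b0 mulmx0 mul0mx addr0 mulmx_sumr (bigD1 i0) //= [X in _ + X]big1
      ?addr0 => [|i ni].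
      rewrite expr0 trmx1 mul1mx mulmx1 mulmxA -trmx_mul.
      by have := Upr i0; rewrite expr0 mulmx1 eqxx => ->; rewrite trmx1 mul1mx.
    have pRU : pr^T *m (R ^+ i)^T *m U^T = 0.
      by rewrite -!trmx_mul mulmxA Upr (negPf ni) raddf0 trmx0.
    by rewrite !mulmxA pRU !mul0mx.
  by rewrite a0 b0 !linear0 row_mx0.
have E2F : E2 *m F = F *m ltsquare_mx e.
  rewrite norm_mxE /ltsquare_mx linear_sum linear_sum mulmx_suml mulmx_sumr.
  by apply: eq_bigr => i _; apply: tsquare_mx_exp.
have rE2 : (\rank E2 <= r * n.+1)%N.
  have Ff : row_free F by rewrite row_free_unit.
  rewrite -(mxrankMfree E2 Ff) E2F.
  apply: leq_trans (mxrankM_maxr _ _) _.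
  have -> : ltsquare_mx e = lin_mulmx (col_base e)^T *m lin_mulmx (row_base e)^T.
    apply: eq_mul_mxvec => X; rewrite ltsquare_mxE mulmxA !mul_vec_lin /=.
    by rewrite mulmxA -trmx_mul mulmx_base.
  by apply: leq_trans (mxrankM_maxl _ _) _; apply: rank_leq_col.
have := leq_trans (mxrankM_maxr J E2) rE2; rewrite (eqP JE : \rank (J *m E2) = _).
rewrite -[X in (_ <= X)%N]addn0 leq_add2l leqn0 muln_eq0 mxrank_coker.
rewrite [r == 0%N]eqn0Ngt rank_norm_gt0 orbF subn_eq0 (eqP Gfree : \rank G = _) => nmr.
have mrn : (m * r <= n.+1)%N by rewrite -(eqP Gfree : \rank G = _) rank_leq_col.
by apply/dvdnP; exists r; rewrite mulnC; apply/eqP; rewrite eqn_leq nmr.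
Qed.

End Unipotent.

Section FreePowers.

Variables (k : fieldType) (n : nat).
Implicit Types R : 'M[k]_n.+1.

Lemma mxminpoly_free_powers R m : (0 < m)%N -> R ^+ m = 1 ->
  (forall c : 'I_m -> k, \sum_i c i *: R ^+ i = 0 -> forall i, c i = 0) ->
  mxminpoly R = 'X^m - 1.
Proof.
move=> m_gt0 Rm Rfree; apply/eqP.
rewrite -eqp_monic ?mxminpoly_monic ?monicXnsubC //.
have mdvd : mxminpoly R %| 'X^m - 1.
  by apply: mxminpoly_min; rewrite rmorphB rmorphXn rmorph1 /= horner_mx_X Rm subrr.
have pm0 : ('X^m - 1 : {poly k}) != 0 by rewrite monic_neq0 ?monicXnsubC.
rewrite -dvdp_size_eqp // eqn_leq dvdp_leq // size_XnsubC // ltnNge.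
apply/negP => sz.
have : mxminpoly R = 0.
  apply/polyP => i; rewrite coef0.
  have [im | mi] := ltnP i m; last by rewrite nth_default // (leq_trans sz).
  apply: (Rfree (fun i => (mxminpoly R)`_i) _ (Ordinal im)).
  rewrite -[RHS](mx_root_minpoly R).
  have minRE : mxminpoly R = \poly_(i < m) (mxminpoly R)`_i.
    apply/polyP => j; rewrite coef_poly; case: ltnP => // mj.
    by rewrite nth_default // (leq_trans sz).
  rewrite [in RHS]minRE poly_def linear_sum; apply: eq_bigr => j _.
  by rewrite linearZ rmorphXn /= horner_mx_X.
by apply/eqP; rewrite monic_neq0 ?mxminpoly_monic.
Qed.

(** A relation between the first m powers of R^s is a polynomial relation of degree less than s m
    for R. *)
Lemma mxminpoly_exp R m s : (0 < m)%N -> (0 < s)%N ->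
  mxminpoly R = 'X^(s * m) - 1 -> mxminpoly (R ^+ s) = 'X^m - 1.
Proof.
move=> m_gt0 s_gt0 minR.
have sm_gt0 : (0 < s * m)%N by rewrite muln_gt0 s_gt0.
apply: mxminpoly_free_powers => // [|c cR i].
  apply/eqP; rewrite -exprM -subr_eq0; apply/eqP.
  by have := mx_root_minpoly R; rewrite minR rmorphB rmorphXn rmorph1 /= horner_mx_X.
pose p : {poly k} := \sum_(i < m) c i *: 'X^(s * i).
have pR : horner_mx R p = 0.
  rewrite -[RHS]cR linear_sum; apply: eq_bigr => j _.
  by rewrite linearZ rmorphXn /= horner_mx_X exprM.
have p0 : p = 0.
  apply/eqP; apply: contraTT (mxminpoly_min pR) => p0; rewrite minR.
  apply: contraL (leqnn (s * m)) => /dvdp_leq-/(_ p0); rewrite size_XnsubC //.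
  rewrite -!ltnNge => /leq_trans; apply; rewrite -ltnS.
  apply: leq_ltn_trans (size_sum _ _ _) _; rewrite ltnS; apply/bigmax_leqP => j _.
  apply: leq_trans (size_scale_leq _ _) _; rewrite size_polyXn.
  by rewrite ltn_pmul2l.
have := congr1 (fun q : {poly k} => q`_(s * i)) p0; rewrite coef0 /p coef_sum.
rewrite (bigD1 i) //= coefZ coefXn eqxx mulr1 big1 ?addr0 // => j nj.
by rewrite coefZ coefXn eqn_pmul2l // eq_sym val_eqE (negPf nj) mulr0.
Qed.

Lemma Xn_sub1_pchar q e : q \in [pchar k] ->
  'X^(q ^ e) - 1 = ('X - 1) ^+ (q ^ e) :> {poly k}.
Proof.
move=> qk.
have qp : q \in [pchar {poly k}] by rewrite pchar_poly.
elim: e => [|e IHe]; first by rewrite expn0 !expr1.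
rewrite expnSr !exprM -IHe -!(pFrobenius_autE qp).
by rewrite rmorphB rmorph1.
Qed.

(** For a prime q dividing m, with q-part m_q, the power R^(m / m_q) has minimal polynomial X^(m_q)
    - 1. The unipotent case applies if q is the characteristic, the separable one otherwise. *)
Lemma dvdn_tsquare R F m : (0 < m)%N -> F \in unitmx ->
  tsquare_mx R *m F = F *m ltsquare_mx R -> R ^+ m = 1 ->
  (forall c : 'I_m -> k, \sum_i c i *: R ^+ i = 0 -> forall i, c i = 0) ->
  (m %| n.+1)%N.
Proof.
move=> m_gt0 Fu RF Rm Rfree.
have minR := mxminpoly_free_powers m_gt0 Rm Rfree.
apply/dvdn_partP => // q qm.
have q_pr : prime q by move: qm; rewrite mem_primes => /andP[].
set s := (m %/ m`_q)%N; have mE : (s * m`_q)%N = m by rewrite divnK // dvdn_part.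
have mq_gt0 : (0 < m`_q)%N by apply: part_gt0.
have s_gt0 : (0 < s)%N by move: m_gt0; rewrite -mE muln_gt0 => /andP[].
have minRs : mxminpoly (R ^+ s) = 'X^(m`_q) - 1.
  by apply: mxminpoly_exp => //; rewrite mE.
have RFs := tsquare_mx_exp s RF.
have [qk | nqk] := boolP (q \in [pchar k]).
  apply: (dvdn_tsquare_unipotent mq_gt0 _ minRs Fu RFs).
  by rewrite p_part Xn_sub1_pchar.
apply: (dvdn_tsquare_separable Fu RFs minRs).
rewrite natf_neq0_pchar; apply: sub_in_pnat (part_pnat q m) => p _.
by rewrite !inE => /eqP->.
Qed.

End FreePowers.

Section PowerOrder.

Variables (k : fieldType) (n : nat) (R : 'M[k]_n) (F : 'M[k]_(n * n)).
Hypotheses (Ru : R \in unitmx) (Fu : F \in unitmx).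
Hypothesis RF : tsquare_mx R *m F = F *m ltsquare_mx R.
Hypothesis R_indep : forall s, (forall i j, i < j < s -> R ^+ i != R ^+ j)%N ->
  forall c : 'I_s -> k, \sum_i c i *: R ^+ i = 0 -> forall i, c i = 0.

(** R has finite order, since n^2 + 1 distinct powers would be independent in a space of dimension
    n^2. Below the order powers are distinct, hence independent, and [dvdn_tsquare] applies. *)
Lemma expr_dim_eq1 : R ^+ n = 1.
Proof.
case: n R F Ru Fu RF R_indep => [|n'] M G Mu Gu MG Mi; first by rewrite expr0.
have [m m_gt0 Mm] : exists2 m, (0 < m)%N & M ^+ m = 1.
  pose s := (n'.+1 * n'.+1).+1.
  have [/existsP[j /existsP[i /andP[ij /eqP Mij]]] | none] :=
    boolP [exists j : 'I_s, exists i : 'I_s, (i < j)%N && (M ^+ i == M ^+ j)].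
    exists (j - i)%N; first by rewrite subn_gt0.
    have Mun : M ^+ i \is a GRing.unit by rewrite unitrX.
    by apply: (mulrI Mun); rewrite -exprD subnKC ?(ltnW ij) // -Mij mulr1.
  pose X := [tuple M ^+ i | i < s].
  have Mfree : free X.
    apply/freeP => c cM; apply: Mi => [i j /andP[ij js]|].
      apply: contraNneq none => Mij; apply/existsP; exists (Ordinal js).
      by apply/existsP; exists (Ordinal (ltn_trans ij js)); rewrite ij Mij /=.
    by rewrite -[RHS]cM; apply: eq_bigr => i _; rewrite -tnth_nth tnth_mktuple.
  have := dimvS (subvf <<X>>%VS).
  by rewrite (eqP Mfree) size_tuple dimvf ltnn.
have Mex : exists m, (0 < m)%N && (M ^+ m == 1) by exists m; rewrite m_gt0 Mm eqxx.
case: (ex_minnP Mex) => d /andP[d_gt0 /eqP Md] dmin.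
have /dvdnP[q nqd] : (d %| n'.+1)%N.
  apply: (dvdn_tsquare d_gt0 Gu MG Md); apply: Mi => i j /andP[ij jd].
  apply/eqP => Mij; have Mun : M ^+ i \is a GRing.unit by rewrite unitrX.
  have := dmin (j - i)%N; rewrite subn_gt0 ij /=.
  have -> : M ^+ (j - i) = 1.
    by apply: (mulrI Mun); rewrite -exprD subnKC ?(ltnW ij) // -Mij mulr1.
  by rewrite eqxx leqNgt => /(_ isT)/negP; apply;
    apply: leq_ltn_trans (leq_subr _ _) jd.
by rewrite [X in M ^+ X]nqd mulnC exprM Md expr1n.
Qed.

End PowerOrder.

(** * Orders of grouplike elements and characters *)

Section EndomorphismOrder.

Variables (k : fieldType) (V : vectType k) (T : V -> V)
  (Phi : tensor V V -> tensor V V).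
Hypotheses (Tl : linear T) (T_inj : injective T).
Hypotheses (Phil : linear Phi) (Phi_inj : injective Phi).
Hypothesis PhiT : forall t, Phi (tmap T T t) = tmap T id (Phi t).
Hypothesis T_indep : forall s,
  (forall i j, (i < j < s)%N -> exists x, iter i T x != iter j T x) ->
  forall c : 'I_s -> k, (forall x, \sum_i c i *: iter i T x = 0) -> forall i, c i = 0.

Local Notation E := (vbasis {:V}).
Local Notation N := (\dim {:V}).

Let M : 'M[k]_N := \matrix_(i, j) coord E j (T E`_i).
Let cv x : 'rV[k]_N := \row_j coord E j x.

Let cvl : linear cv.
Proof. by move=> c x y; apply/rowP => j; rewrite !mxE linearP. Qed.

Let cv_inj : injective cv.
Proof.
move=> x y /rowP xy; rewrite (coord_vbasis (memvf x)) (coord_vbasis (memvf y)).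
by apply: eq_bigr => i _; have := xy i; rewrite !mxE => ->.
Qed.

Let coordE (i j : 'I_N) : coord E i E`_j = (i == j)%:R.
Proof. by rewrite coord_free ?(basis_free (vbasisP _)) // eq_sym. Qed.

Let cvT x : cv (T x) = cv x *m M.
Proof.
apply/rowP => j; rewrite !mxE [in LHS](coord_vbasis (memvf x)).
rewrite (linear_bigsum _ _ _ Tl) linear_sum; apply: eq_bigr => i _.
by rewrite (linear_scale _ _ Tl) linearZ !mxE.
Qed.

Let cv_iter i x : cv (iter i T x) = cv x *m M ^+ i.
Proof.
elim: i => [|i IHi]; first by rewrite expr0 mulmx1.
by rewrite iterS cvT IHi exprSr mulmxA.
Qed.

Let cv_basis i : cv E`_(i : 'I_N) = delta_mx 0 i.
Proof. by apply/rowP => j; rewrite !mxE coordE. Qed.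

Let cv_surj u : exists x, cv x = u.
Proof.
exists (\sum_i u 0 i *: E`_i); apply/rowP => j.
rewrite mxE linear_sum (bigD1 j) //= big1 ?addr0 => [|i ni].
  by rewrite linearZ /= coordE eqxx mulr1.
by rewrite linearZ /= coordE eq_sym (negPf ni) mulr0.
Qed.

Let tmapE (f g : V -> V) (t : tensor V V) (Mf Mg : 'M[k]_N) :
  (forall i j, Mf i j = coord E j (f E`_i)) ->
  (forall i j, Mg i j = coord E j (g E`_i)) ->
  tmap f g t = Mf^T *m (t : 'M[k]_N) *m Mg :> 'M[k]_N.
Proof.
move=> MfE MgE; apply/matrixP => p q.
rewrite summxE mxE.
transitivity (\sum_i \sum_j t i j * (Mf i p * Mg j q)).
  apply: eq_bigr => i _; rewrite summxE; apply: eq_bigr => j _.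
  by rewrite !mxE MfE MgE.
rewrite exchange_big /=; apply: eq_bigr => j _; rewrite mxE mulr_suml.
by apply: eq_bigr => i _; rewrite mxE mulrA [t i j * _]mulrC.
Qed.

(** On coordinate rows T is multiplication by [M], and [PhiT] says that the matrix of [Phi]
    conjugates M (x) M to M (x) id, so [expr_dim_eq1] applies. *)
Lemma iter_dim_id x : iter N T x = x.
Proof.
suff MN : M ^+ N = 1 by apply: cv_inj; rewrite cv_iter MN mulmx1.
pose phi : 'M[k]_N -> 'M[k]_N := Phi.
have phil : linear phi := Phil.
pose phiL : {linear 'M[k]_N -> 'M[k]_N} := HB.pack phi
  (GRing.isLinear.Build k _ _ _ phi phil).
apply: (@expr_dim_eq1 _ _ M (lin_mx phiL)).
- rewrite -row_free_unit; apply: inj_row_free => u uM.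
  have [y yu] := cv_surj u; move: uM; rewrite -yu -cvT => Ty.
  have -> : y = 0; last by rewrite (linear_zero cvl).
  apply: T_inj; rewrite (linear_zero Tl); apply: cv_inj.
  by rewrite Ty (linear_zero cvl).
- rewrite -row_free_unit; apply: inj_row_free => u.
  rewrite -[u]vec_mxK mul_vec_lin => u0; suff -> : vec_mx u = 0 by rewrite linear0.
  apply: Phi_inj; rewrite (linear_zero Phil).
  by apply: (can_inj mxvecK); rewrite u0 linear0.
- apply: eq_mul_mxvec => X; rewrite mulmxA tsquare_mxE [in RHS]mulmxA !mul_vec_lin /=.
  congr (mxvec _); rewrite /phi.
  have <- : tmap T T X = M^T *m X *m M by apply: tmapE => i j; rewrite mxE.
  rewrite PhiT; rewrite (tmapE _ (Mf := M) (Mg := 1%:M)) ?mulmx1 // => i j;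
    rewrite mxE //.
  by rewrite coordE eq_sym.
move=> s Mdiff c cM; apply: T_indep => [i j ijs | y].
  have Mij := Mdiff i j ijs.
  have [/existsP[l nl] | /existsPn eql] := boolP
    [exists l : 'I_N, iter i T E`_l != iter j T E`_l].
    by exists E`_l.
  case/eqP: Mij; apply/row_matrixP => l; rewrite !rowE -cv_basis -!cv_iter.
  by have /negPn/eqP-> := eql l.
apply: cv_inj; rewrite (linear_bigsum _ _ _ cvl) (linear_zero cvl).
transitivity (cv y *m (\sum_(i < s) c i *: M ^+ i)); last by rewrite cM mulmx0.
rewrite mulmx_sumr; apply: eq_bigr => i _.
by rewrite (linear_scale _ _ cvl) cv_iter scalemxAr.
Qed.

End EndomorphismOrder.

Section Dedekind.

Variables (k : fieldType) (X : Type) (op : X -> X -> X) (P : X -> Prop).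
Hypothesis P_op : forall x y, P x -> P y -> P (op x y).

(** Dedekind's argument: subtracting chi_s(y) times the relation from its translate by y kills the
    last term and multiplies the i-th coefficient by chi_i(y) - chi_s(y). [P] serves to restrict to
    linear functionals when X is the type of all functions on A. *)
Lemma characters_independent s (chi : nat -> X -> k) :
  (forall i x y, (i < s)%N -> P x -> P y -> chi i (op x y) = chi i x * chi i y) ->
  (forall i, (i < s)%N -> exists2 x, P x & chi i x != 0) ->
  (forall i j, (i < j < s)%N -> exists2 x, P x & chi i x != chi j x) ->
  forall c : nat -> k, (forall x, P x -> \sum_(i < s) c i * chi i x = 0) ->
  forall i, (i < s)%N -> c i = 0.
Proof.
elim: s => // s IHs chiM chi0 chiD c cchi.
have cs i : (i < s)%N -> c i = 0.
  move=> i_s; have [y Py /eqP dy] : exists2 y, P y & chi i y != chi s y.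
    by apply: chiD; rewrite i_s /=.
  have : c i * (chi i y - chi s y) = 0.
    apply: (IHs _ _ _ (fun i => c i * (chi i y - chi s y))) i_s =>
      [j u v js|j js|j l /andP[jl ls]|x Px].
    - by apply: chiM; apply: ltnW.
    - by apply: chi0; apply: ltnW.
    - by apply: chiD; rewrite jl ltnW.
    transitivity (\sum_(j < s.+1) c j * chi j (op y x) -
        chi s y * \sum_(j < s.+1) c j * chi j x); last first.
      by rewrite !cchi ?mulr0 ?subrr //; apply: P_op.
    rewrite !big_ord_recr /= mulrDr opprD addrACA.
    rewrite chiM // [c s * (_ * _)]mulrCA subrr addr0 mulr_sumr -sumrB.
    apply: eq_bigr => j _; rewrite chiM ?ltnS 1?ltnW //.
    by rewrite mulrBr mulrBl -!mulrA; congr (_ - _); rewrite mulrCA.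
  by move/eqP; rewrite mulf_eq0 subr_eq0 => /orP[/eqP | /eqP].
move=> i; rewrite ltnS leq_eqVlt => /orP[/eqP-> | /cs //].
have [x Px nx] := chi0 s (ltnSn s).
have := cchi x Px; rewrite big_ord_recr big1 /= => [|j _]; last by rewrite cs ?mul0r.
by rewrite add0r => /eqP; rewrite mulf_eq0 (negPf nx) orbF => /eqP.
Qed.

End Dedekind.

Section TensorExt.

Variables (k : fieldType) (V W : vectType k).

Lemma tlift_ext (s t : tensor V W) :
  (forall (X : lmodType k) (b : V -> W -> X), bilinear_map b -> tlift b s = tlift b t)
    ->
  s = t.
Proof. by move=> st; rewrite -[s]tlift_tpure -[t]tlift_tpure;
  apply/st/tpure_bilinear. Qed.

Lemma tlift_tlift (U V' : vectType k) (X : lmodType k) (b : V' -> U -> X)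
    (B : V -> W -> tensor V' U) t :
  tlift b (tlift B t) = tlift (fun v w => tlift b (B v w)) t.
Proof. by apply: tlift_app; apply: tlift_linear. Qed.

End TensorExt.

Section CharacterOrders.

Variables (k : fieldType) (A : hopfAlgebra k).
Implicit Types (x y z h u v g : A) (nu f : A -> k^o) (X : lmodType k).

Local Notation "x ** y" := (alg_mul (ha_alg A) x y) (at level 40, left associativity).
Local Notation "1_A" := (alg_one (ha_alg A)).
Local Notation S := (ha_antipode A).
Local Notation eps := (ha_counit A).
Local Notation D := (ha_comul A).
Local Notation N := (\dim {:A}).

Lemma ord_extend (s : nat) (c : 'I_s -> k) : exists c' : nat -> k, forall i : 'I_s,
  c' i = c i.
Proof. by exists (fun i => oapp c 0 (insub i)) => i; rewrite valK. Qed.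

Lemma vect_neq (x y : A) : x != y -> exists2 f : A -> k^o, linear f & f x != f y.
Proof.
move=> xy; have [/existsP[l nl] | /existsPn eql] :=
    boolP [exists l : 'I_N, coord (vbasis {:A}) l x != coord (vbasis {:A}) l y].
  by exists (coord (vbasis {:A}) l); [lin | exact: nl].
case/eqP: xy; rewrite -(sum_coord_vbasis x) -(sum_coord_vbasis y).
by apply: eq_bigr => l _; have /negPn/eqP-> := eql l.
Qed.

Section GrouplikeOrder.

Variable g : A.
Hypothesis gg : grouplike g.

Local Notation L := (alg_mul (ha_alg A) g).
Let gp i := iter i L 1_A.

Lemma iter_mulg i x : iter i L x = gp i ** x.
Proof. by elim: i => [|i IHi] /=; rewrite ?hmul1l // IHi hmulA. Qed.

Lemma grouplike_iter i : grouplike (gp i).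
Proof.
elim: i => [|i [IHD IHe]] /=; first by split; [apply: ha_comul1 | apply: ha_counit1].
have [Dg eg] := gg; split; first by rewrite ha_comulM Dg IHD tmul_pure.
by rewrite ha_counitM eg [X in _ * X]IHe mulr1.
Qed.

(** x (x) y |-> x_1 (x) S(x_2) y. Since S(g x_2) g y = S(x_2) y, multiplication by g on both factors
    becomes multiplication on the first alone. *)
Let Phi (t : tensor A A) : tensor A A :=
  tlift (fun x y => tlift (fun a b => tpure a (S b ** y)) (D x)) t.
Let Psi (t : tensor A A) : tensor A A :=
  tlift (fun x y => tlift (fun a b => tpure a (b ** y)) (D x)) t.

Let PhiK : cancel Phi Psi.
Proof.
move=> t; apply: tlift_ext => X b bb; rewrite /Psi tlift_tlift /Phi tlift_tlift.
apply: eq_tlift => x y; rewrite tlift_tlift.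
transitivity (tlift (fun u v => tlift (fun c d => b c (d ** (S v ** y))) (D u)) (D x)).
  apply: eq_tlift => u v; rewrite tlift_pure; last by lin.
  rewrite tlift_tlift; apply: eq_tlift => c d; rewrite tlift_pure //.
rewrite ha_coassoc; last by lin.
rewrite -(counitr_app (f := fun x => b x y)); last by lin.
apply: eq_tlift => u v.
transitivity (tlift (fun a d => b u (a ** S d ** y)) (D v)).
  by apply: eq_tlift => a d; rewrite hmulA.
by rewrite (antipoder_app (f := fun z => b u (z ** y))) ?hmul1l //; lin.
Qed.

Let PhiL t : Phi (tmap L L t) = tmap L id (Phi t).
Proof.
apply: tlift_ext => X b bb.
rewrite /tmap /Phi !tlift_tlift; apply: eq_tlift => x y.
rewrite !tlift_tlift tlift_pure; last by lin.
rewrite tlift_tlift sweedlerM; last by lin.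
have [Dg _] := gg; rewrite Dg tlift_pure; last by lin.
apply: eq_tlift => u v; rewrite !tlift_pure //; try lin.
by rewrite antipodeM -hmulA [_ ** (g ** y)]hmulA (grouplike_antipodel gg) hmul1l.
Qed.

Lemma grouplike_order_dim : iter N L 1_A = 1_A.
Proof.
apply: (@iter_dim_id _ _ L Phi).
- by lin.
- move=> x y /(congr1 (fun z => S g ** z)).
  by rewrite !hmulA (grouplike_antipodel gg) !hmul1l.
- by rewrite /Phi; lin.
- exact: can_inj PhiK.
- exact: PhiL.
move=> s gdiff c cg; have [c' c'E] := ord_extend c => i; rewrite -c'E.
(* Evaluation at a power of g is multiplicative for convolution on the dual, because that power is
   grouplike. *)
apply: (@characters_independent k (A -> k^o)
  (fun f f' x => tlift (fun u v => (f u : k) *: (f' v : k^o)) (D x))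
  (fun f => linear f) _ s (fun i f => f (gp i))) => //.
- by move=> f f' fl fl'; lin.
- move=> {}i f f' _ fl fl'; have [-> _] := grouplike_iter i.
  by rewrite tlift_pure //; lin.
- move=> {}i _; exists eps; first by lin.
  by have [_ ->] := grouplike_iter i; apply: oner_neq0.
- move=> {}i j /gdiff[x]; rewrite !iter_mulg => nx; apply: vect_neq.
  by apply: contraNneq nx => ->.
move=> f fl; transitivity (f (\sum_(i < s) c i *: iter i L 1_A)); last first.
  by rewrite cg (linear_zero fl).
rewrite (linear_bigsum _ _ _ fl); apply: eq_bigr => j _.
by rewrite c'E (linear_scale _ _ fl).
Qed.

End GrouplikeOrder.

Section CharacterOrder.

Variable nu : A -> k^o.
Hypothesis nuc : character nu.

Let nul : linear nu. Proof. by case: nuc. Qed.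
Let nu1 : nu 1_A = 1. Proof. by case: nuc. Qed.
Let nuM x y : nu (x ** y) = (nu x : k) * (nu y : k). Proof. by case: nuc. Qed.

Local Notation T := (@transll k A nu).

Let Tl : linear T. Proof. exact: linear_transll. Qed.

Lemma transll_comp f h : linear f ->
  transll f (T h) = transll (fun x => f (T x)) h.
Proof.
move=> fl; rewrite /transll.
rewrite (tlift_app (f := fun z => tlift (fun u v => (f u : k) *: v) (D z)));
  last by lin.
transitivity (tlift (fun p w =>
  tlift (fun u v => (nu p : k) *: ((f u : k) *: v)) (D w)) (D h)).
  apply: eq_tlift => p w; rewrite !linearZ /=
    (tlift_app (f := fun z => (nu p : k) *: z)) //; lin.
rewrite -ha_coassoc; last by lin.
apply: eq_tlift => w v; rewrite (tlift_app (f := f)) //.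
rewrite (tlift_app (f := fun z : k^o => (z : k) *: v)); last by move=> c x y;
  rewrite scalerDl scalerA.
by apply: eq_tlift => a b; rewrite (linear_scale _ _ fl) scalerA.
Qed.

Lemma transllM x y : T (x ** y) = T x ** T y.
Proof.
rewrite /transll sweedlerM; last by lin.
rewrite (tlift_app (f := fun z => z ** tlift _ (D y))); last by lin.
apply: eq_tlift => p q; rewrite (tlift_app (f := fun z => ((nu p : k) *: q) ** z));
  last by lin.
by apply: eq_tlift => u v; rewrite nuM hmulZl hmulZr scalerA.
Qed.

Lemma transll1 : T 1_A = 1_A.
Proof. by rewrite /transll sweedler1 ?nu1 ?scale1r //; lin. Qed.

Let chi i x : k^o := eps (iter i T x).

Let chil i : linear (chi i).
Proof. by have := linear_iter i Tl => it_l; rewrite /chi; lin. Qed.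

Lemma transll_iter i h : iter i T h = transll (chi i) h.
Proof.
elim: i h => [|i IHi] h; first by rewrite /transll /chi /= ha_counitl.
rewrite iterSr IHi transll_comp //.
by apply: eq_tlift => u v; rewrite /chi -iterSr.
Qed.

(** Translation by nu S, the convolution inverse of nu, undoes it. *)
Lemma transll_inj : injective T.
Proof.
apply: (can_inj (g := transll (fun x => nu (S x)))) => h.
rewrite transll_comp; last by lin.
suff nuT u : nu (S (T u)) = eps u.
  by rewrite -[RHS]ha_counitl; apply: eq_tlift => u v; rewrite nuT.
rewrite /transll (tlift_app (f := fun z => nu (S z))); last by lin.
transitivity (tlift (fun a b => nu (a ** S b)) (D u)).
  by apply: eq_tlift => a b; rewrite nuM linearZ (linear_scale _ _ nul).
by rewrite (antipoder_app (f := nu)) // nu1; apply: mulr1.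
Qed.

(** x (x) y |-> x y_1 (x) y_2. Left translation touches only the first leg of a coproduct and is
    multiplicative, so T(x) T(y)_1 (x) T(y)_2 = T(x y_1) (x) y_2. *)
Let Phi (t : tensor A A) : tensor A A :=
  tlift (fun x y => tlift (fun a b => tpure (x ** a) b) (D y)) t.
Let Psi (t : tensor A A) : tensor A A :=
  tlift (fun x y => tlift (fun a b => tpure (x ** S a) b) (D y)) t.

Let PhiK : cancel Phi Psi.
Proof.
move=> t; apply: tlift_ext => X b bb; rewrite /Psi tlift_tlift /Phi tlift_tlift.
apply: eq_tlift => x y; rewrite tlift_tlift.
transitivity (tlift (fun u v => tlift (fun c d => b (x ** u ** S c) d) (D v)) (D y)).
  apply: eq_tlift => u v; rewrite tlift_pure; last by lin.
  rewrite tlift_tlift; apply: eq_tlift => c d; rewrite tlift_pure //.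
rewrite -ha_coassoc; last by lin.
rewrite -(counitl_app (f := fun y => b x y)); last by lin.
apply: eq_tlift => u v.
transitivity (tlift (fun a d => b (x ** (a ** S d)) v) (D u)).
  by apply: eq_tlift => a d; rewrite hmulA.
by rewrite (antipoder_app (f := fun z => b (x ** z) v)) ?hmul1r //; lin.
Qed.

Let PhiT t : Phi (tmap T T t) = tmap T id (Phi t).
Proof.
apply: tlift_ext => X b bb.
rewrite /tmap /Phi !tlift_tlift; apply: eq_tlift => x y.
rewrite !tlift_tlift tlift_pure; last by lin.
rewrite tlift_tlift.
transitivity (tlift (fun a c => b (T x ** a) c) (D (T y))).
  by apply: eq_tlift => a c; rewrite tlift_pure.
rewrite [T y]/transll
  (tlift_app (f := fun z => tlift (fun a c => b (T x ** a) c) (D z))); last by lin.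
transitivity (tlift (fun p q => tlift (fun a c => (nu p : k) *: b (T x ** a) c) (D q))
  (D y)).
  apply: eq_tlift => p q; rewrite !linearZ /=
    (tlift_app (f := fun z : X => (nu p : k) *: z)) //; lin.
rewrite -ha_coassoc; last by lin.
apply: eq_tlift => w c; rewrite !tlift_pure //; try lin.
rewrite transllM [T w]/transll (tlift_app (f := fun z => b (T x ** z) c)); last by lin.
by apply: eq_tlift =>
  p a; rewrite (linear_scale _ _ (f := fun z => b (T x ** z) c)) //; lin.
Qed.

Lemma character_order_dim h : iter N T h = h.
Proof.
apply: (@iter_dim_id _ _ T Phi).
- exact: Tl.
- exact: transll_inj.
- by rewrite /Phi; lin.
- exact: can_inj PhiK.
- exact: PhiT.
move=> s Tdiff c cT; have [c' c'E] := ord_extend c => i; rewrite -c'E.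
apply: (@characters_independent k A (alg_mul (ha_alg A)) (fun=> True) _ s chi) => //.
- move=> {}i x y _ _ _; rewrite /chi.
  suff -> : iter i T (x ** y) = iter i T x ** iter i T y by apply: ha_counitM.
  by elim: i => [|i IHi] //=; rewrite IHi transllM.
- move=> {}i _; exists 1_A => //; rewrite /chi.
  have -> : iter i T 1_A = 1_A by elim: i => [|i IHi] //=; rewrite IHi transll1.
  by rewrite ha_counit1 oner_neq0.
- move=> {}i j /Tdiff[x]; rewrite !transll_iter => nx.
  have [/existsP[l nl] | /existsPn eql] :=
    boolP [exists l : 'I_N, chi i (vbasis {:A})`_l != chi j (vbasis {:A})`_l].
    by exists (vbasis {:A})`_l.
  case/eqP: nx; apply: eq_tlift => u v; congr (_ *: _).
  rewrite -(sum_coord_vbasis u) !(linear_bigsum _ _ _ (chil _)).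
  apply: eq_bigr => l _; rewrite !(linear_scale _ _ (chil _)).
  by have /negPn/eqP-> := eql l.
move=> x _; transitivity (eps (\sum_(i < s) c i *: iter i T x)); last first.
  by rewrite cT linear0.
by rewrite linear_sum; apply: eq_bigr => j _; rewrite c'E linearZ.
Qed.

End CharacterOrder.

Theorem antipode_order h : iter (4 * N) S h = h.
Proof.
have N0 : (0 < N)%N.
  rewrite lt0n dimv_eq0; apply/eqP => A0; have := alg1_neq0 A.
  by have := memvf (1_A : A); rewrite A0 memv0 => ->.
rewrite mulnC iterM; apply: (antipode4_order N0) => [g gg|nu nuc x].
  exact: grouplike_order_dim.
exact: character_order_dim.
Qed.

End CharacterOrders.

(** * Components of a Hopf pi-coalgebra *)

Section GradedHopf.

Variables (k : fieldType) (pi : groupType) (H : hopfPiCoalgebra k pi).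

(* The structure maps of H with the identifications between indices as
   arguments, so that these can be eliminated by substitution. *)
Definition gcomul (a b c : pi) (e : c = (a * b)%g) :
  {linear H c -> tensor (H a) (H b)} :=
  ecast g {linear H g -> tensor (H a) (H b)} (esym e) (pi_comul H a b).

Definition gcounit (c : pi) (e : c = 1%g) : {linear H c -> k^o} :=
  ecast g {linear H g -> k^o} (esym e) (pi_counit H).

Definition gantipode (a b : pi) (e : b = (a^-1)%g) : {linear H a -> H b} :=
  ecast g {linear H a -> H g} (esym e) (hopf_antipode H a).

Lemma gcomul_ecast a b c (e : c = (a * b)%g) (e' : (a * b)%g = c) x :
  gcomul e x = pi_comul H a b (ecast g (H g) e x).
Proof. by subst c. Qed.

Lemma gantipode_ecast a b (e : b = (a^-1)%g) (e' : (a^-1)%g = b) x :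
  gantipode e x = ecast g (H g) e' (hopf_antipode H a x).
Proof. by subst b; rewrite [e'](eq_irrelevance _ erefl). Qed.

Lemma linear_gantipode_ecast a b (e : (a^-1)%g = b) :
  linear (fun x => ecast g (H g) e (hopf_antipode H a x)).
Proof. by move=> c x y; rewrite -!(gantipode_ecast (esym e)) linearP. Qed.

Lemma gcoassoc (X : lmodType k) (a b c ab bc abc : pi)
    (t : H a -> H b -> H c -> X) (e1 : ab = (a * b)%g) (e2 : bc = (b * c)%g)
    (e3 : abc = (ab * c)%g) (e4 : abc = (a * bc)%g) x : trilinear_map t ->
  tlift (fun u v => tlift (fun p q => t p q v) (gcomul e1 u)) (gcomul e3 x) =
  tlift (fun u v => tlift (fun q r => t u q r) (gcomul e2 v)) (gcomul e4 x).
Proof.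
move=> tt; subst ab bc abc.
have tb2 u : bilinear_map (t u) by lin.
have b2 : bilinear_map (fun u w => tlift (t u) w) by lin.
have := congr1 (tlift (fun u w => tlift (t u) w)) (pi_coassoc (p := H) x).
rewrite /tassoc tlift_tmap; try lin.
rewrite [in RHS]tlift_tmap; try lin.
rewrite tlift_tlift =>
  E; transitivity (tlift (fun u v => tlift (t u) (pi_comul H b c v))
  (pi_comul H a (b * c)%g (ecast g (H g) (esym (mulgA a b c)) x))); last first.
  by rewrite [e4](eq_irrelevance _ (esym (mulgA a b c)))
    -(gcomul_ecast _ (mulgA a b c)).
rewrite -E; apply: eq_tlift => u v; rewrite tlift_tlift; apply: eq_tlift => p q.
by rewrite !tlift_pure //; lin.
Qed.

Lemma gcounitl (u c : pi) (e0 : u = 1%g) (e : c = (u * c)%g) x :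
  tlift (fun p q => (gcounit e0 p : k) *: q) (gcomul e x) = x.
Proof.
subst u; rewrite -[RHS](pi_counitl (p := H)) /tunitl tlift_tmap; try lin.
rewrite [e](eq_irrelevance _ (esym (mul1g c))).
by rewrite (gcomul_ecast _ (mul1g c)).
Qed.

Lemma gcounitr (u c : pi) (e0 : u = 1%g) (e : c = (c * u)%g) x :
  tlift (fun p q => (gcounit e0 q : k) *: p) (gcomul e x) = x.
Proof.
subst u; rewrite -[RHS](pi_counitr (p := H)) /tunitr tlift_tmap; try lin.
rewrite [e](eq_irrelevance _ (esym (mulg1 c))).
by rewrite (gcomul_ecast _ (mulg1 c)).
Qed.

Lemma gcomulM (a b c : pi) (e : c = (a * b)%g) x y :
  gcomul e (alg_mul (hopf_alg H c) x y) =
  tmul (hopf_alg H a) (hopf_alg H b) (gcomul e x) (gcomul e y).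
Proof. by subst c; case: (hopf_comul_morphism H a b) => _ ->. Qed.

Lemma gcomul1 (a b c : pi) (e : c = (a * b)%g) :
  gcomul e (alg_one (hopf_alg H c)) = tpure (alg_one (hopf_alg H a))
    (alg_one (hopf_alg H b)).
Proof. by subst c; case: (hopf_comul_morphism H a b). Qed.

Lemma gcounitM c (e : c = 1%g) x y :
  gcounit e (alg_mul (hopf_alg H c) x y) = (gcounit e x : k) * (gcounit e y : k).
Proof. by subst c; case: (hopf_counit_morphism H) => _ ->. Qed.

Lemma gcounit1 c (e : c = 1%g) : gcounit e (alg_one (hopf_alg H c)) = 1.
Proof. by subst c; case: (hopf_counit_morphism H). Qed.

Lemma gantipodel (a b u : pi) (e0 : u = 1%g) (e : u = (b * a)%g) (eb : b = (a^-1)%g)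
    (ea : a = (b^-1)%g) x :
  tlift (fun p q => alg_mul (hopf_alg H a) (gantipode ea p) q) (gcomul e x) =
  (gcounit e0 x : k) *: alg_one (hopf_alg H a).
Proof.
subst b u; have := @hopf_antipodel k pi H a x.
have Sl := linear_gantipode_ecast (invgK a).
rewrite /alg_mul_tensor tlift_tmap; try lin.
rewrite [e](eq_irrelevance _ (esym (mulVg a))) -(gcomul_ecast _ (mulVg a)) => <-.
by apply: eq_tlift => p q; rewrite (gantipode_ecast _ (invgK a)).
Qed.

Lemma gantipoder (a b u : pi) (e0 : u = 1%g) (e : u = (a * b)%g) (eb : b = (a^-1)%g)
    (ea : a = (b^-1)%g) x :
  tlift (fun p q => alg_mul (hopf_alg H a) p (gantipode ea q)) (gcomul e x) =
  (gcounit e0 x : k) *: alg_one (hopf_alg H a).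
Proof.
subst b u; have := @hopf_antipoder k pi H a x.
have Sl := linear_gantipode_ecast (invgK a).
rewrite /alg_mul_tensor tlift_tmap; try lin.
rewrite [e](eq_irrelevance _ (esym (mulgV a))) -(gcomul_ecast _ (mulgV a)) => <-.
by apply: eq_tlift => p q; rewrite (gantipode_ecast _ (invgK a)).
Qed.

Lemma gantipode2 (a b : pi) (eb : b = (a^-1)%g) (ea : a = (b^-1)%g) x :
  gantipode ea (gantipode eb x) = antipode2 x.
Proof.
by subst b; rewrite /antipode2 (gantipode_ecast _ (invgK a)).
Qed.

End GradedHopf.

Arguments gcomul {k pi H a b c} e.
Arguments gcounit {k pi H c} e.
Arguments gantipode {k pi H a b} e.

Section Dimensions.

Variable k : fieldType.

Definition linear_pack (U V : lmodType k) (f : U -> V) (fl : linear f) :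
  {linear U -> V} :=
  HB.pack f (GRing.isLinear.Build k U V *:%R f fl).

Lemma dim_injective (U V : vectType k) (f : U -> V) :
  linear f -> injective f -> (dim U <= dim V)%N.
Proof.
move=> fl f_inj; pose F := linfun (linear_pack fl).
have kF : lker F == 0%VS by apply/lker0P => x y; rewrite !lfunE; apply: f_inj.
by rewrite -!dimvf -(limg_dim_eq _ (f := F)) ?dimvS ?subvf // (eqP kF) capv0.
Qed.

Lemma dim_tensor (U V : vectType k) : dim (tensor U V) = (dim U * dim V)%N.
Proof. by rewrite -[in RHS]dimvf -[dim V]dimvf. Qed.

Lemma tpure_eq0 (U V : vectType k) (u : U) (v : V) : u != 0 -> v != 0 -> tpure u v != 0.
Proof.
have nz (W : vectType k) (w : W) : w != 0 -> exists i, coord (vbasis {:W}) i w != 0.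
  move=> w0; apply/existsP; apply: contraNT w0 => /existsPn c0.
  rewrite (coord_vbasis (memvf w)) big1 // => i _.
  by have /negPn/eqP-> := c0 i; rewrite scale0r.
move=> /nz[i ui] /nz[j vj]; apply/eqP => /matrixP/(_ i j)/eqP.
by rewrite !mxE mulf_eq0 (negPf ui) (negPf vj).
Qed.

End Dimensions.

Section ComponentDimension.

Variables (k : fieldType) (pi : groupType) (H : hopfPiCoalgebra k pi).

Local Notation one a := (alg_one (hopf_alg H a)).
Local Notation mul a := (alg_mul (hopf_alg H a)).

Lemma one_eq0 a (x : H a) : one a = 0 -> x = 0.
Proof.
move=> e; rewrite -[x](alg_mul1l (hopf_alg H a)) e.
by rewrite (linear_zero (f := fun z => mul a z x)) //; lin.
Qed.

(** The comultiplication sends 1 to 1 (x) 1, which is nonzero. Hence one nonzero component H_alpha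
    makes those of all powers of alpha nonzero. *)
Lemma oneM_neq0 a b : one a != 0 -> one b != 0 -> one (a * b)%g != 0.
Proof.
move=> na nb; apply: contra_neq (tpure_eq0 na nb) => e.
by rewrite -(gcomul1 H (erefl (a * b)%g)) e linear0.
Qed.

Lemma one1_neq0 : one 1%g != 0.
Proof.
apply/eqP => e; have := gcounit1 H (erefl 1%g); rewrite e linear0 => /esym/eqP.
by rewrite (negPf (oner_neq0 _)).
Qed.

(* The Galois map x (x) y |-> x y_1 (x) y_2 from H_a (x) H_a to H_a (x) H_1 is
   bijective, with inverse x (x) y |-> x S(y_1) (x) y_2. *)
Lemma dim_component a : one a != 0 -> dim (H a) = dim (H 1%g).
Proof.
move=> na.
have ea : a = (a * 1)%g by rewrite mulg1.
have e1 : 1%g = (a^-1 * a)%g by rewrite mulVg.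
have e1' : 1%g = (a * a^-1)%g by rewrite mulgV.
have ea' : a = (1 * a)%g by rewrite mul1g.
have eV : a = (a^-1^-1)%g by rewrite invgK.
have e11 : 1%g = (1 * 1)%g :> pi by rewrite mulg1.
pose F (t : tensor (H a) (H a)) : tensor (H a) (H 1%g) :=
  tlift (fun x y => tlift (fun u v => tpure (mul a x u) v) (gcomul ea y)) t.
pose G (t : tensor (H a) (H 1%g)) : tensor (H a) (H a) :=
  tlift (fun x y => tlift (fun u v => tpure (mul a x (gantipode eV u)) v)
    (gcomul e1 y)) t.
have FK : cancel F G.
  move=> t; apply: tlift_ext => X b bb; rewrite /G tlift_tlift /F tlift_tlift.
  apply: eq_tlift => x y; rewrite tlift_tlift.
  transitivity (tlift (fun u v => tlift (fun c d =>
      b (mul a x (mul a u (gantipode eV c))) d) (gcomul e1 v)) (gcomul ea y)).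
    apply: eq_tlift => u v; rewrite tlift_pure; last by lin.
    by rewrite tlift_tlift; apply: eq_tlift => c d; rewrite tlift_pure // alg_mulA.
  rewrite -(gcoassoc e1' e1 ea' ea); last by lin.
  rewrite -[in RHS](gcounitl (erefl 1%g) ea' y) [RHS](tlift_app (f := b x));
    last by lin.
  apply: eq_tlift => u v.
  transitivity (b (mul a x
    (tlift (fun p q => mul a p (gantipode eV q)) (gcomul e1' u))) v).
    by rewrite (tlift_app (f := fun z => b (mul a x z) v)) //; lin.
  rewrite (gantipoder (erefl 1%g)) //.
  rewrite (linear_scale _ _ (f := fun z => b (mul a x z) v)); last by lin.
  by rewrite alg_mul1r (linear_scale _ _ (f := b x)) //; lin.
have GK : cancel G F.
  move=> t; apply: tlift_ext => X b bb; rewrite /F tlift_tlift /G tlift_tlift.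
  apply: eq_tlift => x y; rewrite tlift_tlift.
  transitivity (tlift (fun u v => tlift (fun c d =>
      b (mul a x (mul a (gantipode eV u) c)) d) (gcomul ea v)) (gcomul e1 y)).
    apply: eq_tlift => u v; rewrite tlift_pure; last by lin.
    by rewrite tlift_tlift; apply: eq_tlift => c d; rewrite tlift_pure // alg_mulA.
  rewrite -(gcoassoc e1 ea e11 e1); last by lin.
  rewrite -[in RHS](gcounitl (erefl 1%g) e11 y) [RHS](tlift_app (f := b x));
    last by lin.
  apply: eq_tlift => u v.
  transitivity (b (mul a x
    (tlift (fun p q => mul a (gantipode eV p) q) (gcomul e1 u))) v).
    by rewrite (tlift_app (f := fun z => b (mul a x z) v)) //; lin.
  rewrite (gantipodel (erefl 1%g)) //.
  rewrite (linear_scale _ _ (f := fun z => b (mul a x z) v)); last by lin.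
  by rewrite alg_mul1r (linear_scale _ _ (f := b x)) //; lin.
have Fl : linear F by rewrite /F; lin.
have Gl : linear G by rewrite /G; lin.
have : dim (tensor (H a) (H a)) = dim (tensor (H a) (H 1%g)).
  apply/eqP; rewrite eqn_leq (dim_injective Fl (can_inj FK)).
  by rewrite (dim_injective Gl (can_inj GK)).
(* The common factor dim H_a cancels, being positive because the unit of H_a is nonzero. *)
rewrite !dim_tensor => /eqP; rewrite eqn_mul2l => /orP[d0 | /eqP //].
case/eqP: na; apply/eqP; rewrite -memv0.
have -> : 0%VS = {:H a}%VS :> {vspace H a}; last exact: memvf.
by apply/esym/eqP; rewrite -dimv_eq0 dimvf.
Qed.

End ComponentDimension.

(** * The sum of the components over a cyclic group *)

Section DirectSum.

Variables (k : fieldType) (pi : groupType) (H : hopfPiCoalgebra k pi).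
Variables (I : finZmodType) (a : I -> pi).
Hypotheses (a0 : a 0 = 1%g) (aD : forall i j, a (i + j) = (a i * a j)%g).

Variables (A : vectType k) (inj : forall i, {linear H (a i) -> A})
  (prj : forall i, {linear A -> H (a i)}).
Hypotheses (injK : forall i, cancel (inj i) (prj i))
  (prj_inj0 : forall i j x, i != j -> prj i (inj j x) = 0)
  (sum_prj : forall x, \sum_i inj i (prj i x) = x).

Local Notation one i := (alg_one (hopf_alg H (a i))).
Local Notation mul i := (alg_mul (hopf_alg H (a i))).

Lemma prj_sum (x : forall i, H (a i)) i : prj i (\sum_j inj j (x j)) = x i.
Proof.
rewrite linear_sum (bigD1 i) //= injK big1 ?addr0 // => j nj.
by rewrite prj_inj0 // eq_sym.
Qed.

Lemma prj_ext x y : (forall i, prj i x = prj i y) -> x = y.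
Proof. by move=> xy; rewrite -[x]sum_prj -[y]sum_prj; apply: eq_bigr => i _;
  rewrite xy. Qed.

(** As an algebra the sum is the product of the components; only the comultiplication and the
    antipode relate different indices. *)
Definition ds_mul (x y : A) : A := \sum_i inj i (mul i (prj i x) (prj i y)).
Definition ds_one : A := \sum_i inj i (one i).

Lemma prj_mul i x y : prj i (ds_mul x y) = mul i (prj i x) (prj i y).
Proof. exact: prj_sum. Qed.

Lemma prj_one i : prj i ds_one = one i.
Proof. exact: prj_sum. Qed.

Lemma ds_mul_bilinear : bilinear_map ds_mul.
Proof. by rewrite /ds_mul; lin. Qed.

Lemma ds_mulA : associative ds_mul.
Proof. by move=> x y z; apply: prj_ext => i; rewrite !prj_mul alg_mulA. Qed.

Lemma ds_mul1l : left_id ds_one ds_mul.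
Proof. by move=> x; apply: prj_ext => i; rewrite prj_mul prj_one alg_mul1l. Qed.

Lemma ds_mul1r : right_id ds_one ds_mul.
Proof. by move=> x; apply: prj_ext => i; rewrite prj_mul prj_one alg_mul1r. Qed.

Definition ds_alg := AlgebraOn ds_mul_bilinear ds_mulA ds_mul1l ds_mul1r.

Lemma ds_mul_inj i x y : ds_mul (inj i x) (inj i y) = inj i (mul i x y).
Proof.
apply: prj_ext => j; rewrite prj_mul.
have [<-|nij] := eqVneq i j; first by rewrite !injK.
rewrite !prj_inj0 1?eq_sym //.
by rewrite (linear_zero (f := fun z => mul j z 0)) //; lin.
Qed.

Lemma ds_mul_inj0 i j x y : i != j -> ds_mul (inj i x) (inj j y) = 0.
Proof.
move=> nij; apply: prj_ext => l; rewrite prj_mul linear0.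
have [<-|nil] := eqVneq i l.
  rewrite (prj_inj0 _ nij) (linear_zero (f := fun z => mul i _ z)) //; lin.
rewrite (prj_inj0 (i := l) (j := i)) 1?eq_sym //.
by rewrite (linear_zero (f := fun z => mul l z _)) //; lin.
Qed.

(** The component of degree l goes to all pairs (i, j) with i + j = l, finitely many because [I] is
    finite. *)
Definition ds_comul_fun (x : A) : tensor A A :=
  \sum_i \sum_j tmap (inj i) (inj j) (gcomul (aD i j) (prj (i + j) x)).

Lemma ds_comul_linear : linear ds_comul_fun.
Proof.
rewrite /ds_comul_fun; apply: linear_sum_fun => i; apply: linear_sum_fun => j.
by rewrite /tmap; lin.
Qed.

Definition ds_comul := linear_pack ds_comul_linear.

Lemma tlift_ds_comul (X : lmodType k) (b : A -> A -> X) x : bilinear_map b ->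
  tlift b (ds_comul x) = \sum_i \sum_j
    tlift (fun u v => b (inj i u) (inj j v)) (gcomul (aD i j) (prj (i + j) x)).
Proof.
move=> bb; rewrite [ds_comul x]/(ds_comul_fun x) linear_sum; apply: eq_bigr => i _.
rewrite linear_sum; apply: eq_bigr => j _; apply: tlift_tmap => //.
  exact: linearP.
exact: linearP.
Qed.

Lemma gcomul_prj (i j : I) (b c : pi) (eij : i = j) (e : a i = (b * c)%g)
    (e' : a j = (b * c)%g) x : gcomul e (prj i x) = gcomul e' (prj j x).
Proof. by subst j; rewrite (eq_irrelevance e e'). Qed.

Lemma gcounit_prj (i j : I) (eij : i = j) (e : a i = 1%g) (e' : a j = 1%g) x :
  gcounit e (prj i x) = gcounit e' (prj j x).
Proof. by subst j; rewrite (eq_irrelevance e e'). Qed.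

Definition ds_counit_fun (x : A) : k^o := gcounit a0 (prj 0 x).

Lemma ds_counit_linear : linear ds_counit_fun.
Proof. by rewrite /ds_counit_fun; lin. Qed.

Definition ds_counit := linear_pack ds_counit_linear.

Lemma aN i : a (- i) = (a i)^-1%g.
Proof. by apply: (mulgI (a i)); rewrite -aD subrr a0 mulgV. Qed.

Definition ds_antipode_fun (x : A) : A := \sum_i inj (- i) (gantipode (aN i) (prj i x)).

Lemma ds_antipode_linear : linear ds_antipode_fun.
Proof. by rewrite /ds_antipode_fun; lin. Qed.

Definition ds_antipode := linear_pack ds_antipode_linear.

Lemma ds_antipode_inj i x : ds_antipode_fun (inj i x) = inj (- i) (gantipode (aN i) x).
Proof.
rewrite /ds_antipode_fun (bigD1 i) //= injK.
by rewrite big1 ?addr0 // => j nj; rewrite prj_inj0 ?linear0.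
Qed.

Lemma ds_coassoc (X : lmodType k) (t : A -> A -> A -> X) x : trilinear_map t ->
  tlift (fun u v => tlift (fun p q => t p q v) (ds_comul u)) (ds_comul x) =
  tlift (fun u v => tlift (fun p q => t u p q) (ds_comul v)) (ds_comul x).
Proof.
move=> tt; rewrite !tlift_ds_comul; try lin.
transitivity (\sum_i \sum_j \sum_l tlift (fun u v => tlift (fun p q =>
    t (inj i p) (inj j q) (inj l v)) (gcomul (aD i j) u))
  (gcomul (aD (i + j) l) (prj (i + j + l) x))).
  (* m is the index of the leg that is split a second time; only m = i + j survives. *)
  transitivity (\sum_m \sum_l \sum_i \sum_j tlift (fun u v => tlift (fun p q =>
      t (inj i p) (inj j q) (inj l v)) (gcomul (aD i j) (prj (i + j) (inj m u))))
    (gcomul (aD m l) (prj (m + l) x))).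
    apply: eq_bigr => m _; apply: eq_bigr => l _.
    transitivity (tlift (fun u v => \sum_i \sum_j tlift (fun p q =>
      t (inj i p) (inj j q) (inj l v)) (gcomul (aD i j) (prj (i + j) (inj m u))))
      (gcomul (aD m l) (prj (m + l) x))).
      by apply: eq_tlift => u v; rewrite tlift_ds_comul //; lin.
    rewrite tlift_sum; apply: eq_bigr => i _; exact: tlift_sum.
  rewrite exchange_big.
  transitivity (\sum_l \sum_i \sum_j \sum_m tlift (fun u v => tlift (fun p q =>
      t (inj i p) (inj j q) (inj l v)) (gcomul (aD i j) (prj (i + j) (inj m u))))
    (gcomul (aD m l) (prj (m + l) x))).
    apply: eq_bigr => l _ /=; rewrite exchange_big; apply: eq_bigr => i _ /=.
    exact: exchange_big.
  rewrite exchange_big; apply: eq_bigr => i _ /=.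
  rewrite exchange_big; apply: eq_bigr => j _ /=; apply: eq_bigr => l _.
  rewrite (bigD1 (i + j)) //= [X in _ + X]big1 ?addr0 => [|m nm].
    by apply: eq_tlift => u v; rewrite injK.
  by apply: tlift_eq0 => u v; rewrite prj_inj0 1?eq_sym // linear0 linear0.
transitivity (\sum_i \sum_j \sum_l tlift (fun u v => tlift (fun p q =>
    t (inj i u) (inj j p) (inj l q)) (gcomul (aD j l) v))
  (gcomul (aD i (j + l)) (prj (i + (j + l)) x))).
  apply: eq_bigr => i _; apply: eq_bigr => j _; apply: eq_bigr => l _.
  have e4 : a (i + j + l) = (a i * a (j + l))%g by rewrite -aD addrA.
  rewrite (gcoassoc _ (aD j l) _ e4); last by lin.
  by rewrite (gcomul_prj (esym (addrA i j l)) e4 (aD i (j + l))).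
apply: eq_bigr => i _.
transitivity (\sum_m \sum_j \sum_l tlift (fun u v => tlift (fun p q =>
    t (inj i u) (inj j p) (inj l q)) (gcomul (aD j l) (prj (j + l) (inj m v))))
  (gcomul (aD i m) (prj (i + m) x))).
  rewrite [RHS]exchange_big; apply: eq_bigr => j _ /=.
  rewrite [RHS]exchange_big; apply: eq_bigr => l _ /=.
  rewrite [RHS](bigD1 (j + l)) //= [X in _ = _ + X]big1 ?addr0 => [|m nm].
    by apply: eq_tlift => u v; rewrite injK.
  by apply: tlift_eq0 => u v; rewrite prj_inj0 1?eq_sym // linear0 linear0.
apply: eq_bigr => m _.
transitivity (tlift (fun u v => \sum_j \sum_l tlift (fun p q =>
  t (inj i u) (inj j p) (inj l q)) (gcomul (aD j l) (prj (j + l) (inj m v))))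
  (gcomul (aD i m) (prj (i + m) x))).
  by rewrite tlift_sum; apply: eq_bigr => j _; rewrite tlift_sum.
by apply: eq_tlift => u v; rewrite tlift_ds_comul //; lin.
Qed.

Lemma ds_counit_inj0 x : ds_counit_fun (inj 0 x) = gcounit a0 x.
Proof. by rewrite /ds_counit_fun injK. Qed.

Lemma ds_counit_inj i x : i != 0 -> ds_counit_fun (inj i x) = 0.
Proof.
by move=> ni; rewrite /ds_counit_fun prj_inj0 1?eq_sym ?linear0.
Qed.

Lemma ds_counitl x : tlift (fun u v => (ds_counit u : k) *: v) (ds_comul x) = x.
Proof.
rewrite tlift_ds_comul; last by lin.
rewrite (bigD1 0) //= [X in _ + X]big1 ?addr0 => [|i ni]; last first.
  by rewrite big1 // => j _; apply: tlift_eq0 => u v; rewrite ds_counit_inj ?scale0r.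
rewrite -[RHS]sum_prj; apply: eq_bigr => j _.
have e : a j = (a 0 * a j)%g by rewrite a0 mul1g.
rewrite (gcomul_prj (add0r j) _ e) -[in RHS](gcounitl a0 e (prj j x)).
rewrite [RHS](tlift_app (f := inj j)); last exact: linearP.
by apply: eq_tlift => u v; rewrite /= ds_counit_inj0 linearZ.
Qed.

Lemma ds_counitr x : tlift (fun u v => (ds_counit v : k) *: u) (ds_comul x) = x.
Proof.
rewrite tlift_ds_comul; last by lin.
rewrite -[RHS]sum_prj; apply: eq_bigr => j _.
rewrite (bigD1 0) //= [X in _ + X]big1 ?addr0 => [|i ni]; last first.
  by apply: tlift_eq0 => u v; rewrite ds_counit_inj ?scale0r.
have e : a j = (a j * a 0)%g by rewrite a0 mulg1.
rewrite (gcomul_prj (addr0 j) _ e) -[in RHS](gcounitr a0 e (prj j x)).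
rewrite [RHS](tlift_app (f := inj j)); last exact: linearP.
by apply: eq_tlift => u v; rewrite /= ds_counit_inj0 linearZ.
Qed.

Lemma ds_comul1 : ds_comul ds_one = tpure ds_one ds_one.
Proof.
apply: tlift_ext => X b bb; rewrite tlift_ds_comul // tlift_pure //.
rewrite {2}/ds_one (linear_bigsum _ _ _ (f := fun z => b z ds_one)); last by lin.
apply: eq_bigr => i _; rewrite {1}/ds_one
  (linear_bigsum _ _ _ (f := b (inj i (one i)))); last by lin.
apply: eq_bigr => j _; rewrite prj_one gcomul1 tlift_pure //; lin.
Qed.

Lemma ds_comulM x y :
  ds_comul (ds_mul x y) = tmul ds_alg ds_alg (ds_comul x) (ds_comul y).
Proof.
apply: tlift_ext => X b bb; rewrite tlift_ds_comul // /tmul tlift_tlift.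
transitivity (tlift (fun p q => tlift (fun u v => b (ds_mul p u) (ds_mul q v))
   (ds_comul y)) (ds_comul x)); last first.
  apply: eq_tlift => p q; rewrite tlift_tlift; apply: eq_tlift => u v.
  by rewrite tlift_pure.
have mb := ds_mul_bilinear.
rewrite [RHS]tlift_ds_comul; last by lin.
apply: eq_bigr => i _; apply: eq_bigr => j _.
rewrite prj_mul gcomulM /tmul tlift_tlift; apply: eq_tlift => p q.
rewrite tlift_tlift tlift_ds_comul; last by lin.
rewrite (bigD1 i) //= [X in _ = _ + X]big1 ?addr0 => [|i' ni]; last first.
  rewrite big1 // => j' _; apply: tlift_eq0 => u v.
  by rewrite ds_mul_inj0 1?eq_sym // (linear_zero (f := fun z => b z _)) //; lin.
rewrite (bigD1 j) //= [X in _ = _ + X]big1 ?addr0 => [|j' nj]; last first.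
  apply: tlift_eq0 => u v.
  by rewrite [X in b _ X]ds_mul_inj0 1?eq_sym // (linear_zero (f := fun z => b _ z))
    //; lin.
by apply: eq_tlift => u v; rewrite tlift_pure ?ds_mul_inj //; lin.
Qed.

Lemma ds_counit1 : ds_counit ds_one = 1.
Proof. by rewrite [LHS]/(ds_counit_fun _) /ds_counit_fun prj_one gcounit1. Qed.

Lemma ds_counitM x y : ds_counit (ds_mul x y) = (ds_counit x : k) * (ds_counit y : k).
Proof. by rewrite [LHS]/(ds_counit_fun _) /ds_counit_fun prj_mul gcounitM. Qed.

Lemma sum_inj_opp_one : \sum_i inj (- i) (one (- i)) = ds_one.
Proof.
by rewrite /ds_one [RHS](reindex_inj oppr_inj).
Qed.

Lemma ds_antipodel x :
  tlift (fun u v => ds_mul (ds_antipode u) v) (ds_comul x) = (ds_counit x : k) *: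
    ds_one.
Proof.
have mb := ds_mul_bilinear.
rewrite tlift_ds_comul; last by lin.
(* The antipode carries degree i to -i, so only j = -i contributes, in degree -i; the unit is summed
   in that indexing. *)
rewrite -sum_inj_opp_one scaler_sumr; apply: eq_bigr => i _.
rewrite (bigD1 (- i)) //= [X in _ + X]big1 ?addr0 => [|j nj]; last first.
  by apply: tlift_eq0 => u v; rewrite ds_antipode_inj ds_mul_inj0 // eq_sym.
have e0 : a (i + - i) = 1%g by rewrite subrr.
rewrite -(linear_scale _ _ (f := inj (- i))); last exact: linearP.
rewrite /= /ds_counit_fun -(gcounit_prj (subrr i) e0 a0).
have eV : a i = ((a (- i))^-1)%g by rewrite aN invgK.
rewrite -(gantipodel e0 (aD i (- i)) eV (aN i)).
rewrite [RHS](tlift_app (f := inj (- i))); last exact: linearP.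
by apply: eq_tlift => u v; rewrite /= ds_antipode_inj ds_mul_inj.
Qed.

Lemma ds_antipoder x :
  tlift (fun u v => ds_mul u (ds_antipode v)) (ds_comul x) = (ds_counit x : k) *:
    ds_one.
Proof.
have mb := ds_mul_bilinear.
rewrite tlift_ds_comul; last by lin.
rewrite [X in _ *: X]/ds_one scaler_sumr; apply: eq_bigr => i _.
have [j ij] : exists j, i = - j by exists (- i); rewrite opprK.
rewrite (bigD1 j) //= [X in _ + X]big1 ?addr0 => [|l nl]; last first.
  apply: tlift_eq0 => u v; rewrite ds_antipode_inj ds_mul_inj0 //.
  by apply: contraNneq nl => il; rewrite -(opprK l) -il ij opprK.
subst i.
have e0 : a (- j + j) = 1%g by rewrite addNr.
rewrite -(linear_scale _ _ (f := inj (- j))); last exact: linearP.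
rewrite /= /ds_counit_fun -(gcounit_prj (addNr j) e0 a0).
have eV : a j = ((a (- j))^-1)%g by rewrite aN invgK.
rewrite -(gantipoder e0 (aD (- j) j) eV (aN j)).
rewrite [RHS](tlift_app (f := inj (- j))); last exact: linearP.
by apply: eq_tlift => u v; rewrite /= ds_antipode_inj ds_mul_inj.
Qed.

Definition direct_sum_hopf : hopfAlgebra k :=
  @HopfAlgebra k A ds_alg ds_comul ds_counit ds_antipode ds_coassoc ds_counitl
    ds_counitr
    ds_comul1 ds_comulM ds_counit1 ds_counitM ds_antipodel ds_antipoder.

Lemma ds_antipode2 i x : ds_antipode (ds_antipode (inj i x)) = inj i (antipode2 x).
Proof.
have inj_gantipode2 j (ij : i = j) (e : a (- i) = (a i)^-1%g)
  (e' : a j = (a (- i))^-1%g) :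
    inj j (gantipode e' (gantipode e x)) = inj i (antipode2 x).
  by subst j; rewrite gantipode2.
by rewrite /= !ds_antipode_inj inj_gantipode2 ?opprK.
Qed.

(** The square of the antipode preserves each component and is [antipode2] there, so the exponent of
    [antipode_order] is halved. *)
Lemma antipode2_order i (x : H (a i)) :
  iter (2 * \dim {:A}) (@antipode2 k pi H (a i)) x = x.
Proof.
have E n : iter (2 * n) ds_antipode (inj i x) = inj i
  (iter n (@antipode2 k pi H (a i)) x).
  by elim: n => [|n IHn]; rewrite ?muln0 // mulnS iterD IHn [LHS]ds_antipode2 iterS.
have := @antipode_order k direct_sum_hopf (inj i x).
have -> : (4 * \dim {:A} = 2 * (2 * \dim {:A}))%N by rewrite mulnA.
by rewrite [LHS]E => /(congr1 (prj i)); rewrite !injK.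
Qed.

End DirectSum.

Section CyclicSum.

Variables (k : fieldType).

Lemma row_iso (V : vectType k) n : dim V = n ->
  {fg : {linear V -> 'rV[k]_n} * {linear 'rV[k]_n -> V} | cancel fg.1 fg.2 & cancel
    fg.2 fg.1}.
Proof.
rewrite -dimvf => <-; set E := vbasis {:V}.
have fl : linear (fun x => \row_i coord E i x).
  by move=> c x y; apply/rowP => i; rewrite !mxE linearP.
have gl : linear (fun u : 'rV[k]_(\dim {:V}) => \sum_i u 0 i *: E`_i).
  move=> c u v; rewrite scaler_sumr -big_split; apply: eq_bigr => i _ /=.
  by rewrite !mxE scalerDl scalerA.
exists (linear_pack fl, linear_pack gl) => [x|u] /=.
  rewrite [RHS](coord_vbasis (memvf x)); apply: eq_bigr => i _.
  by rewrite mxE.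
apply/rowP => j; rewrite mxE; apply: coord_sum_free.
exact: (basis_free (vbasisP _)).
Qed.

Variables (pi : groupType) (H : hopfPiCoalgebra k pi).
Variables (I : finZmodType) (a : I -> pi).
Hypotheses (a0 : a 0 = 1%g) (aD : forall i j, a (i + j) = (a i * a j)%g).

(** Equal dimensions let every component be modelled by ['rV[k]_n], so that the sum is a space of
    plain functions on [I], of dimension #|I| n. *)
Lemma antipode2_order_equidim n : (forall i, dim (H (a i)) = n) ->
  forall i (x : H (a i)), iter (2 * #|I| * n) (@antipode2 k pi H (a i)) x = x.
Proof.
move=> dimH; pose A : vectType k := {ffun I -> 'rV[k]_n}.
pose f i := (sval (sig_of_sig2 (row_iso (dimH i)))).1.
pose g i := (sval (sig_of_sig2 (row_iso (dimH i)))).2.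
have fK i : cancel (f i) (g i) by rewrite /f /g; case: (row_iso _).
have gK i : cancel (g i) (f i) by rewrite /f /g; case: (row_iso _).
have injl i : linear (fun x : H (a i) => [ffun j => if j == i then f i x else 0] : A).
  move=> c x y; apply/ffunP => j; rewrite !ffunE.
  by case: eqP => _; rewrite ?linearP // scaler0 addr0.
have prjl i : linear (fun z : A => g i (z i)).
  by move=> c x y; rewrite !ffunE linearP.
move=> i x.
have := @antipode2_order k pi H I a a0 aD A (fun i => linear_pack (injl i))
  (fun i => linear_pack (prjl i)).
have -> : \dim {:A} = (#|I| * n)%N by rewrite dimvf -[dim A]/(#|I| * (1 * n))%N mul1n.
rewrite mulnA; apply=> [j y|j l y jl|z] /=.
- by rewrite ffunE eqxx fK.
- by rewrite ffunE (negPf jl) linear0.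
apply/ffunP => j; rewrite sum_ffunE (bigD1 j) //= big1 ?addr0 => [|l lj].
  by rewrite ffunE eqxx gK.
by rewrite ffunE eq_sym (negPf lj).
Qed.

End CyclicSum.

Section FiniteOrder.

Variables (k : fieldType) (pi : groupType) (H : hopfPiCoalgebra k pi).

(** If H_alpha = 0 both sides are zero. Otherwise the components at all powers of alpha have
    dimension dim H_1, and Z/d indexes the sum through i |-> alpha^i. *)
Lemma antipode2_order_cyclic (a : pi) d : has_order a d ->
  forall x : H a, iter (2 * d * dim (H 1%g)) (@antipode2 k pi H a) x = x.
Proof.
case: d => [[]//|d] [_ ad _] x.
have [e | na] := eqVneq (alg_one (hopf_alg H a)) 0.
  by rewrite [LHS](one_eq0 _ e) [RHS](one_eq0 _ e).
have expg_mod m : (a ^+ (m %% d.+1) = a ^+ m)%g.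
  by rewrite [in RHS](divn_eq m d.+1) mulnC expgnDr expgnA ad expg1n mul1g.
have nai i : alg_one (hopf_alg H (a ^+ i)%g) != 0.
  elim: i => [|i IHi]; first exact: one1_neq0.
  by rewrite expgS; apply: oneM_neq0.
have aD (i j : 'I_d.+1) :
  (a ^+ (i + j)%R = a ^+ i * a ^+ j)%g by rewrite expg_mod expgnDr.
have := @antipode2_order_equidim k pi H 'I_d.+1 (fun i => a ^+ i)%g erefl aD _
  (fun i => dim_component (nai i)).
rewrite card_ord => ord.
(* The index becomes a variable [b] so that the claim can be moved from H (a ^+ i) to H a without
   transporting vectors. *)
have {}ord b : (exists i : 'I_d.+1, (a ^+ i)%g = b) ->
    forall y : H b, iter (2 * d.+1 * dim (H 1%g)) (@antipode2 k pi H b) y = y.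
  by case=> i <-; apply: ord.
(* [inZp 1] is 0 when the order is 1; [expg_mod] covers that case too. *)
by apply: ord; exists (inZp 1); rewrite expg_mod expg1.
Qed.

Lemma antipode_endo2 (a : pi) (e : (a^-1)%g = a) (x : H a) :
  antipode_endo e (antipode_endo e x) = antipode2 x.
Proof.
rewrite /antipode_endo -!(gantipode_ecast (esym e)).
by rewrite -(gantipode2 (esym e) (esym e)).
Qed.

End FiniteOrder.

Local Close Scope ring_scope.

Theorem corollary4 (k : fieldType) (pi : groupType) (H : hopfPiCoalgebra k pi) :
  (forall (a : pi) (d : nat), has_order a d ->
     forall x : H a,
       iter (2 * d * dim (H 1%g)) (@antipode2 k pi H a) x = x)
  /\
  (forall (a : pi) (ord2 : has_order a 2),
     forall x : H a,
       iter (8 * dim (H 1%g))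
         (@antipode_endo k pi H a (has_order2_inv ord2)) x = x).
Proof.
split=> [a d|a ord2 x]; first exact: antipode2_order_cyclic.
rewrite -[RHS](antipode2_order_cyclic ord2).
(* The first part for d = 2 has exponent 2 * 2 * dim H_1 on the square of the endomorphism; the last
   factor 2 is that square. *)
have -> : 8 * dim (H 1%g) = (2 * 2 * dim (H 1%g)) * 2 by rewrite mulnAC.
by rewrite iterM; apply: eq_iter => y; apply: antipode_endo2.
Qed.
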